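(* Let $F: U \subset \mathbb{R}^2 \to \mathbb{R}^2$ be an analytic map in a neighborhood $U$ of $(0,0)$ in reduced form (see context). Assume, according to the case to which $F$ belongs: in case 1, $a_k>0$; in case 2, $a_k>0$ and $b_l\neq 0$; in case 3, $b_l<0$. Then there exist $\rho>0$ and a $C^1$ map $K:[0,\rho)\to\mathbb{R}^2$, analytic in $(0,\rho)$, such that, as $t \to 0$, $$K(t)=\begin{cases}(t^2,\;K^y_{k+1}t^{k+1})+(O(t^3),\,O(t^{k+2})) & \text{in case 1},\\ (t,\;K^y_l t^l)+(O(t^2),\,O(t^{l+1})) & \text{in cases 2, 3},\end{cases}$$ with $$K^y_{k+1}=-\sqrt{\frac{2a_k}{c(k+1)}}\ \text{ in case 1},\qquad K^y_l=\frac{b_l-\sqrt{b_l^2+4c\,a_k\,l}}{2cl}\ \text{ in case 2},\qquad K^y_l=\frac{b_l}{cl}\ \text{ in case 3},$$ and a polynomial $R$ of the form $R(t)=t+R_Nt^N+R_{2N-1}t^{2N-1}$, with $R_k=\frac c2 K^y_{k+1}$ in case 1 and $R_l=cK^y_l$ in cases 2, 3, such that $$F(K(t))=K(R(t)),\qquad t\in[0,\rho).$$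
   Context: $\mathbb{R}^2$ carries the norm $\|(x,y)\|=\max\{|x|,|y|\}$. An analytic map $F$ is in reduced form if $$F(x,y)=\begin{pmatrix} x+cy\\ y+p(x)+y\,q(x)+u(x,y)+g(x,y)\end{pmatrix},$$ where $c>0$ and, for some integers $2\le k,l\le r$, $p(x)=x^k(a_k+\cdots+a_rx^{r-k})$, $q(x)=x^{l-1}(b_l+\cdots+b_rx^{r-l})$, $u(x,y)$ is a polynomial all of whose terms have the factor $y^2$, $p(x)+yq(x)+u(x,y)$ is the Taylor polynomial of degree $r$ at the origin of a function $f(x,y)=O(\|(x,y)\|^2)$ (the second component of $F$ being $y+f(x,y)$), and $g$ is analytic with $g(x,y)=o(\|(x,y)\|^r)$. Cases: Case 1: $k<2l-1$ and $a_k\neq0$. Case 2: $k=2l-1$ and $a_k,b_l\neq0$. Case 3: $k>2l-1$ and $b_l\neq0$. Set $N=k$ in case 1 and $N=l$ in cases 2 and 3. *)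

(* Defs.v *)
From mathcomp Require Import all_boot all_order all_algebra.
From mathcomp Require Import all_classical all_reals all_analysis.
Set Implicit Arguments.
Unset Strict Implicit.
Unset Printing Implicit Defensive.
Import Order.TTheory GRing.Theory Num.Theory.
Import numFieldNormedType.Exports.
Local Open Scope classical_set_scope.
Local Open Scope ring_scope.

(* Points of the plane are pairs in R * R, whose library norm is the maximum
   norm and whose order of components is (x, y). *)

(* The power series sum_n s_n h^n converges to f (t0 + h) for |h| < e. *)
Definition analytic_at1 (R : realType) (f : R -> R) (t0 : R) : Prop :=
  exists (s : R ^nat) (e : R), 0 < e /\
    forall h : R, `|h| < e -> pseries s h @ \oo --> f (t0 + h).

(* The double series sum_(i,j) C_ij h1^i h2^j is absolutely convergent on the
   closed polydisc of radius e, and its sum is f (z0 + h) for |h| < e.  Absolute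
   convergence makes the use of square partial sums immaterial. *)
Definition power_series_at2 (R : realType) (f : R * R -> R) (z0 : R * R)
    (C : nat -> nat -> R) : Prop :=
  exists e : R, [/\ 0 < e,
    summable [set: nat * nat]
      (fun ij => (C ij.1 ij.2 * e ^+ (ij.1 + ij.2))%:E)
  & forall h : R * R, `|h| < e ->
      (fun n => \sum_(i < n) \sum_(j < n) C i j * h.1 ^+ i * h.2 ^+ j)
        @ \oo --> f (z0 + h)].

Definition analytic_at2 (R : realType) (f : R * R -> R) (z0 : R * R) : Prop :=
  exists C : nat -> nat -> R, power_series_at2 f z0 C.

Definition analytic_on2 (R : realType) (U : set (R * R)) (f : R * R -> R) : Prop :=
  forall z, U z -> analytic_at2 f z.

Definition analytic_map_on (R : realType) (U : set (R * R))
    (F : R * R -> R * R) : Prop :=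
  analytic_on2 U (fun z => (F z).1) /\ analytic_on2 U (fun z => (F z).2).

(* A curve defined on [0, rho): the derivative is taken within [0, rho), hence is
   one-sided at 0. *)
Definition C1_curve (R : realType) (rho : R) (K : R -> R * R) : Prop :=
  exists dK : R -> R * R,
    {within `[0, rho[, continuous dK} /\
    forall t : R, t \in `[0, rho[ ->
      (s - t)^-1 *: (K s - K t) @[s --> within `[0, rho[ t^'] --> dK t.

Definition analytic_curve (R : realType) (rho : R) (K : R -> R * R) : Prop :=
  forall t : R, t \in `]0, rho[ ->
    analytic_at1 (fun s => (K s).1) t /\ analytic_at1 (fun s => (K s).2) t.

(* Bivariate polynomials are elements of {poly {poly R}}: the outer variable is y
   and the inner one is x, so T`_j`_i is the coefficient of x^i y^j. *)
Definition eval2 (R : realType) (T : {poly {poly R}}) (z : R * R) : R :=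
  T.[z.2%:P].[z.1].

Definition taylor_polynomial (R : realType) (f : R * R -> R) (r : nat)
    (T : {poly {poly R}}) : Prop :=
  exists2 C : nat -> nat -> R, power_series_at2 f 0 C &
    forall i j : nat, T`_j`_i = if (i + j <= r)%N then C i j else 0.

Definition p_poly (R : realType) (k r : nat) (a : nat -> R) : {poly R} :=
  'X^k * \sum_(k <= i < r.+1) a i *: 'X^(i - k).

Definition q_poly (R : realType) (l r : nat) (b : nat -> R) : {poly R} :=
  'X^(l.-1) * \sum_(l <= i < r.+1) b i *: 'X^(i - l).

(* Here y + f is the second component of F.  The bound (total degree <= r) on the
   terms of u is part of taylor_polynomial.  As g is only relevant on U and U is a
   neighbourhood of 0, the estimates do not depend on values outside U. *)
Definition reduced_form (R : realType) (U : set (R * R)) (F : R * R -> R * R)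
    (c : R) (k l r : nat) (a b : nat -> R) (u : {poly {poly R}})
    (g : R * R -> R) : Prop :=
  let p := p_poly k r a in
  let q := q_poly l r b in
  let f := fun z : R * R => (F z).2 - z.2 in
  [/\ 0 < c,
      (2 <= k <= r)%N /\ (2 <= l <= r)%N,
      exists v : {poly {poly R}}, u = 'X^2 * v,
      forall x y : R, U (x, y) ->
        F (x, y) = (x + c * y,
                    y + p.[x] + y * q.[x] + eval2 u (x, y) + g (x, y))
    & [/\ taylor_polynomial f r (p%:P + 'X * q%:P + u),
          f =O_ (0 : R * R) (fun z => `|z| ^+ 2),
          analytic_on2 U g
        & g =o_ (0 : R * R) (fun z => `|z| ^+ r)]].

Inductive reduced_case := Case1 | Case2 | Case3.

Definition in_case (R : realType) (cs : reduced_case) (k l : nat)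
    (a b : nat -> R) : Prop :=
  match cs with
  | Case1 => (k < 2 * l - 1)%N /\ a k != 0
  | Case2 => [/\ k = (2 * l - 1)%N, a k != 0 & b l != 0]
  | Case3 => (k > 2 * l - 1)%N /\ b l != 0
  end.

Definition sign_condition (R : realType) (cs : reduced_case) (k l : nat)
    (a b : nat -> R) : Prop :=
  match cs with
  | Case1 => 0 < a k
  | Case2 => 0 < a k /\ b l != 0
  | Case3 => b l < 0
  end.

Definition case_N (cs : reduced_case) (k l : nat) : nat :=
  if cs is Case1 then k else l.

(* Leading term of K: (t^xexp, Ky t^yexp). *)
Definition xexp (cs : reduced_case) : nat := if cs is Case1 then 2 else 1.

Definition yexp (cs : reduced_case) (k l : nat) : nat :=
  if cs is Case1 then k.+1 else l.

Definition Ky (R : realType) (cs : reduced_case) (c : R) (k l : nat)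
    (a b : nat -> R) : R :=
  match cs with
  | Case1 => - Num.sqrt (2 * a k / (c * k.+1%:R))
  | Case2 => (b l - Num.sqrt (b l ^+ 2 + 4 * c * a k * l%:R)) / (2 * c * l%:R)
  | Case3 => b l / (c * l%:R)
  end.

Definition R_N (R : realType) (cs : reduced_case) (c : R) (k l : nat)
    (a b : nat -> R) : R :=
  if cs is Case1 then c / 2 * Ky cs c k l a b else c * Ky cs c k l a b.

Definition K_asymptotics (R : realType) (cs : reduced_case) (c : R) (k l : nat)
    (a b : nat -> R) (K : R -> R * R) : Prop :=
  (fun t => (K t).1 - t ^+ xexp cs) =O_ (0^'+) (fun t => t ^+ (xexp cs).+1) /\
  (fun t => (K t).2 - Ky cs c k l a b * t ^+ yexp cs k l)
    =O_ (0^'+) (fun t => t ^+ (yexp cs k l).+1).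

(* Main.v *)
(* In all cases K is quasi-homogeneous to leading order,
   K = (t^kappa, y0 t^(kappa + q)) with q = N - 1, and f = sum C_ij x^i y^j only
   contains monomials of weight kappa i + (kappa + q) j >= kappa + 2 q.

   Formal step: the coefficients of K are found order by order.  The linear
   system at order n is singular only for n = q, and there the coefficient of
   t^(2N - 1) in the inner map P is the extra unknown.

   Analytic step: let P be the polynomial found in this way, K_0 a formal
   solution of high order, and f_m the square truncations of f.  The iteration
     X_(m+1) = X_m o P - c Y_m,   Y_(m+1) = Y_m o P - f_m (X_m, Y_m)
   stays within polynomials, and its fixed points solve F o K = K o P.  A
   polynomial is measured at t > 0 by the l^1 norm of its Taylor coefficients at
   t, with radius theta t: this real substitute for the supremum over a complex
   sector is submultiplicative, and since P is attracting, composition with P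
   does not increase it (from P(t) to t) when theta is small.  If the order of
   K_0 is large, the gain P(t)^n <= t^n (1 - const n t^q) beats the Lipschitz
   constants, so the increments have sums O(t^n).  Hence the Taylor coefficients
   at every t > 0 converge, which gives analyticity, and K - K_0 is small enough
   for K to be C^1 up to t = 0. *)

Require Import Defs.
From mathcomp Require Import all_boot all_order all_algebra.
From mathcomp Require Import all_classical all_reals all_analysis.
From mathcomp Require Import ring lra zify.
Import Order.TTheory GRing.Theory Num.Theory.
Import numFieldNormedType.Exports.
Local Open Scope classical_set_scope.
Local Open Scope ring_scope.
Set Implicit Arguments.
Unset Strict Implicit.
Unset Printing Implicit Defensive.

(** * The weighted l^1 norm of polynomials *)

(** The linear part of the map is unipotent, so a step of the iteration contracts by no fixed
    factor: composition with [P] gains only a relative amount of order [n t^q]. All losses must then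
    be of relative order [t^q] too, which dictates the unequal sizes [t^n] for the increments of [X]
    and [t^(n + q)] for those of [Y]: the term [c Y] costs [c t^q], and the weights in [f] give its
    partial derivatives in [x] and [y] the sizes [t^(2 q)] and [t^q]. These costs do not depend on
    [n], so a large [n] pays for them. An increment at [t] is controlled through the previous one at
    [P(t)]; hence the bounds are proved by induction on the number of steps, for all [t] of an
    interval at once, without a function space or a fixed point theorem. The truncation order grows
    by one at each step, and the truncation errors telescope to a bounded sum. The leading equation
    is solved by its negative root [y0]: then [r = c y0 / kappa < 0], so that [P] attracts. *)

Definition l1norm (R : realType) (rho : R) (P : {poly R}) : R :=
  \sum_(i < size P) `|P`_i| * rho ^+ i.

Section L1Norm.
Context {R : realType}.
Implicit Types (P Q : {poly R}) (rho : R).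

Lemma l1norm_widen rho P n : (size P <= n)%N ->
  l1norm rho P = \sum_(i < n) `|P`_i| * rho ^+ i.
Proof.
move=> Pn; rewrite /l1norm (big_ord_widen _ (fun i => `|P`_i| * rho ^+ i) Pn).
rewrite big_mkcond; apply: eq_bigr => i _; case: ltnP => // Pi.
by rewrite nth_default // normr0 mul0r.
Qed.

Lemma l1norm_ge0 rho P : 0 <= rho -> 0 <= l1norm rho P.
Proof. by move=> r0; apply: sumr_ge0 => i _; rewrite mulr_ge0 ?exprn_ge0. Qed.

Lemma l1normC rho (x : R) : l1norm rho x%:P = `|x|.
Proof.
rewrite (@l1norm_widen _ _ 1) ?size_polyC ?leq_b1 //.
by rewrite big_ord1 coefC expr0 mulr1.
Qed.

Lemma l1norm_ZXn rho (x : R) n : l1norm rho (x *: 'X^n) = `|x| * rho ^+ n.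
Proof.
rewrite (@l1norm_widen _ _ n.+1); last first.
  by rewrite (leq_trans (size_scale_leq _ _)) ?size_polyXn.
rewrite big_ord_recr /= coefZ coefXn eqxx mulr1 big1 ?add0r // => i _.
by rewrite coefZ coefXn ltn_eqF // mulr0 normr0 mul0r.
Qed.

Lemma l1normXn rho n : l1norm rho 'X^n = rho ^+ n.
Proof. by rewrite -[X in l1norm _ X]scale1r l1norm_ZXn normr1 mul1r. Qed.

Lemma l1normN rho P : l1norm rho (- P) = l1norm rho P.
Proof.
by rewrite /l1norm size_polyN; apply: eq_bigr => i _; rewrite coefN normrN.
Qed.

Lemma l1normZ rho (x : R) P : l1norm rho (x *: P) = `|x| * l1norm rho P.
Proof.
rewrite (@l1norm_widen _ _ (size P)) ?size_scale_leq // mulr_sumr.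
by apply: eq_bigr => i _; rewrite coefZ normrM mulrA.
Qed.

Lemma l1normD rho P Q : 0 <= rho ->
  l1norm rho (P + Q) <= l1norm rho P + l1norm rho Q.
Proof.
move=> r0; set n := maxn (size P) (size Q).
rewrite !(@l1norm_widen _ _ n) ?leq_maxl ?leq_maxr //; last first.
  exact: leq_trans (size_polyD _ _) _.
rewrite -big_split /=; apply: ler_sum => i _.
by rewrite coefD -mulrDl ler_wpM2r ?exprn_ge0 ?ler_normD.
Qed.

Lemma l1normB rho P Q : 0 <= rho ->
  l1norm rho (P - Q) <= l1norm rho P + l1norm rho Q.
Proof. by move=> r0; rewrite (le_trans (l1normD _ _ r0)) ?l1normN. Qed.

Lemma l1norm_sum rho (I : Type) (s : seq I) (A : pred I) (F : I -> {poly R}) :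
  0 <= rho -> l1norm rho (\sum_(i <- s | A i) F i) <=
    \sum_(i <- s | A i) l1norm rho (F i).
Proof.
move=> r0; elim/big_rec2: _ => [|i x P Ai le_Px].
  by rewrite -[0]/(0%:P) l1normC normr0.
by rewrite (le_trans (l1normD _ _ r0)) // lerD2l.
Qed.

Lemma l1normM rho P Q : 0 <= rho ->
  l1norm rho (P * Q) <= l1norm rho P * l1norm rho Q.
Proof.
move=> r0; rewrite -{1}[P]coefK -{1}[Q]coefK !poly_def mulr_suml.
rewrite (le_trans (l1norm_sum _ _ _ r0)) // [X in _ <= X * _]/l1norm mulr_suml.
apply: ler_sum => i _; rewrite mulr_sumr (le_trans (l1norm_sum _ _ _ r0)) //.
rewrite mulr_sumr; apply: ler_sum => j _.
rewrite -scalerAl -scalerAr scalerA -exprD l1norm_ZXn normrM exprD.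
by rewrite le_eqVlt; apply/orP; left; apply/eqP; ring.
Qed.

Lemma l1norm_exp rho P n : 0 <= rho ->
  l1norm rho (P ^+ n) <= l1norm rho P ^+ n.
Proof.
move=> r0; elim: n => [|n IH]; first by rewrite !expr0 -[1]/(1%:P) l1normC normr1.
rewrite !exprS (le_trans (l1normM _ _ r0)) // ler_wpM2l ?l1norm_ge0 //.
Qed.

Lemma l1norm_le rho1 rho2 P : 0 <= rho1 -> rho1 <= rho2 ->
  l1norm rho1 P <= l1norm rho2 P.
Proof.
move=> r0 r12; apply: ler_sum => i _; rewrite ler_wpM2l //.
by apply: lerXn2r; rewrite ?nnegrE ?(le_trans r0).
Qed.

(** Submultiplicativity bounds the powers of [Q]. In terms of discs: [Q] sends radius [rho] into
    radius [l1norm rho Q], where [P] is then measured. *)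
Lemma l1norm_comp rho P Q : 0 <= rho ->
  l1norm rho (P \Po Q) <= l1norm (l1norm rho Q) P.
Proof.
move=> r0; rewrite comp_polyE (le_trans (l1norm_sum _ _ _ r0)) //.
apply: ler_sum => i _; rewrite l1normZ ler_wpM2l //; exact: l1norm_exp.
Qed.

Lemma normr_horner_le P (h rho : R) : `|h| <= rho -> `|P.[h]| <= l1norm rho P.
Proof.
move=> hr; rewrite horner_coef (le_trans (ler_norm_sum _ _ _)) //.
apply: ler_sum => i _; rewrite normrM normrX ler_wpM2l //.
by apply: lerXn2r; rewrite ?nnegrE // (le_trans _ hr).
Qed.

Lemma normr_coef_le rho P i : 0 <= rho -> `|P`_i| * rho ^+ i <= l1norm rho P.
Proof.
move=> r0; have [Pi|iP] := leqP (size P) i.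
  by rewrite nth_default // normr0 mul0r l1norm_ge0.
rewrite /l1norm (bigD1 (Ordinal iP)) //= lerDl sumr_ge0 // => j _.
by rewrite mulr_ge0 ?exprn_ge0.
Qed.

(** Each term of degree [i >= 2] satisfies [|h|^i <= rho^i (|h| / rho)^2]. This replaces a bound on
    the second derivative and survives limits of polynomials, which is how differentiability of the
    limits is obtained. *)
Lemma horner_sub_linear_le P (h rho : R) : 0 < rho -> `|h| <= rho ->
  `|P.[h] - P.[0] - P`_1 * h| <= l1norm rho P * (`|h| / rho) ^+ 2.
Proof.
move=> r0 hr; set n := (size P).+2.
have -> : P.[h] = \sum_(i < n) P`_i * h ^+ i.
  by rewrite (@horner_coef_wide _ n) // /n !leqW.
rewrite (@l1norm_widen _ _ n) ?/n ?leqW // !big_ord_recl /= horner_coef0.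
rewrite !expr0 !expr1 !mulr1 /bump /= addn0.
under eq_bigr do rewrite !add1n.
under [X in _ <= (_ + (_ + X)) * _]eq_bigr do rewrite !add1n.
rewrite (_ : _ - _ - _ = \sum_(i < size P) P`_(i.+2) * h ^+ i.+2); last first.
  by ring.
set S := \sum_(i < _) _ * rho ^+ _.
apply: (@le_trans _ _ (S * (`|h| / rho) ^+ 2)); last first.
  rewrite ler_wpM2r ?sqr_ge0 // addrA lerDr addr_ge0 // mulr_ge0 //; exact: ltW.
rewrite /S mulr_suml (le_trans (ler_norm_sum _ _ _)) //; apply: ler_sum => i _.
rewrite normrM normrX.
have -> : `|P`_i.+2| * rho ^+ i.+2 * (`|h| / rho) ^+ 2 =
   `|P`_i.+2| * (rho ^+ i * `|h| ^+ 2).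
  by rewrite -addn2 exprD; field; rewrite gt_eqF.
rewrite -addn2 exprD ler_wpM2l // ler_wpM2r ?exprn_ge0 //.
by apply: lerXn2r; rewrite ?nnegrE // ltW.
Qed.

End L1Norm.

(** * Limits of polynomials in the Taylor norm *)

Section DominatedIncrements.
Context {R : realType}.
Variables (D : nat -> R) (B : R).
Hypotheses (D_ge0 : forall m, 0 <= D m).
Hypothesis (D_bounded : forall j, \sum_(m < j) D m <= B).

Let S j := \sum_(m < j) D m.

Let S_nd : {homo S : n m / (n <= m)%N >-> n <= m}.
Proof.
move=> n m nm; rewrite /S -(subnKC nm); elim: (m - n)%N => [|p IH].
  by rewrite addn0.
by rewrite addnS big_ord_recr /= (le_trans IH) // lerDl.
Qed.

Let S_cvg : cvgn S.
Proof.
apply: nondecreasing_is_cvgn => //.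
by exists B => _ [j _ <-]; exact: D_bounded.
Qed.

(** The rank [m] depends on the majorant [D] alone, so it serves at once for all sequences with
    increments below [D]; [poly_lim_pseries] exchanges two limits by this uniformity. *)
Lemma dominated_increments_tail (eps : R) : 0 < eps ->
  exists m, forall j, (m <= j)%N ->
    \sum_(k < j) D k - \sum_(k < m) D k <= eps.
Proof.
move=> e0; have /cvgrPdist_le/(_ _ e0)[m _ mP] := S_cvg.
exists m => j mj; have := mP m (leqnn m); rewrite /= => h.
have := nondecreasing_cvgn_le S_nd S_cvg j.
rewrite -/(S m) -/(S j); move: h; rewrite ler_norml => /andP[_ h] h'.
by rewrite lerBlDr (le_trans h') // -lerBlDr.
Qed.

Lemma dominated_increments_dist (u : nat -> R) :
  (forall m, `|u m.+1 - u m| <= D m) ->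
  forall m j, (m <= j)%N ->
    `|u j - u m| <= \sum_(k < j) D k - \sum_(k < m) D k.
Proof.
move=> uD m j mj; rewrite -(subnKC mj); elim: (j - m)%N => [|p IH].
  by rewrite addn0 !subrr normr0.
rewrite addnS big_ord_recr /= addrAC.
have -> : u (m + p).+1 - u m = (u (m + p)%N - u m) + (u (m + p).+1 - u (m + p)%N).
  by ring.
by rewrite (le_trans (ler_normD _ _)) // lerD.
Qed.

Lemma dominated_increments_cvg (u : nat -> R) :
  (forall m, `|u m.+1 - u m| <= D m) -> cvgn u.
Proof.
(* Adding the partial sums of [D] makes [u] nondecreasing, so monotone convergence applies to [v]
   and [S] separately. *)
move=> uD; pose v m := S m + u m.
have v_cvg : cvgn v.
  apply: nondecreasing_is_cvgn.
    apply: (@homo_leq _ v (fun x y => x <= y)) => //; first exact: le_trans.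
    move=> m; rewrite /v /S big_ord_recr /= -addrA lerD2l.
    have := uD m; rewrite ler_norml => /andP[h _]; lra.
  exists (B + (u 0%N + B)) => _ [j _ <-]; apply: lerD; first exact: D_bounded.
  have := dominated_increments_dist uD (leq0n j).
  rewrite big_ord0 subr0 ler_norml => /andP[_ h].
  have := D_bounded j; lra.
have -> : u = (fun m => v m - S m) by apply/funext => m; rewrite /v; ring.
exact: is_cvgB.
Qed.

Lemma dominated_increments_lim (u : nat -> R) (m : nat) (eps : R) :
  (forall m, `|u m.+1 - u m| <= D m) ->
  (forall j, (m <= j)%N -> \sum_(k < j) D k - \sum_(k < m) D k <= eps) ->
  `|limn u - u m| <= eps.
Proof.
move=> uD Se; have u_cvg := dominated_increments_cvg uD.
have h : `|u j - u m| @[j --> \oo] --> `|limn u - u m|.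
  by apply: cvg_norm; apply: cvgB => //; exact: cvg_cst.
rewrite -(cvg_lim (@Rhausdorff R) h); apply: limr_le.
  by apply/cvg_ex; exists `|limn u - u m|.
exists m => // j /= mj; apply: le_trans (Se j mj).
exact: dominated_increments_dist.
Qed.

End DominatedIncrements.

Lemma cvgn_sum_ord (R : realType) (n : nat) (u : nat -> nat -> R) (l : nat -> R) :
  (forall i, u i m @[m --> \oo] --> l i) ->
  \sum_(i < n) u i m @[m --> \oo] --> \sum_(i < n) l i.
Proof.
move=> ul; elim: n => [|n IH].
  under eq_fun do rewrite big_ord0.
  by rewrite big_ord0; exact: cvg_cst.
under eq_fun do rewrite big_ord_recr.
by rewrite big_ord_recr; apply: cvgD => //; exact: ul.
Qed.

Definition taylor_norm (R : realType) (eta t : R) (P : {poly R}) : R :=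
  l1norm eta (P \Po ('X + t%:P)).

Section PolynomialLimits.
Context {R : realType}.
Variables (P : nat -> {poly R}) (t eta B : R).
Hypothesis eta_ge0 : 0 <= eta.
Hypothesis P_bounded :
  forall j, \sum_(m < j) taylor_norm eta t (P m.+1 - P m) <= B.

Let D m := taylor_norm eta t (P m.+1 - P m).
Let D_ge0 m : 0 <= D m.
Proof. exact: l1norm_ge0. Qed.

Let phi x := limn (fun m => (P m).[x]).
Let c m i := (P m \Po ('X + t%:P))`_i.
Let s i := limn (c^~ i).

Let horner_inc h : `|h| <= eta ->
  forall m, `|(P m.+1).[t + h] - (P m).[t + h]| <= D m.
Proof.
move=> heta m; apply: (le_trans _ (normr_horner_le _ heta)).
by rewrite horner_comp !hornerE /= (addrC t).
Qed.

Lemma poly_lim_cvg h : `|h| <= eta ->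
  (P m).[t + h] @[m --> \oo] --> phi (t + h).
Proof. by move/horner_inc; exact: dominated_increments_cvg. Qed.

Lemma poly_lim_dist h : `|h| <= eta -> `|phi (t + h) - (P 0).[t + h]| <= B.
Proof.
move/horner_inc => inc.
apply: (dominated_increments_lim D_ge0 P_bounded inc) => j _.
by rewrite big_ord0 subr0; exact: P_bounded.
Qed.

Let coef_inc i m : `|c m.+1 i * eta ^+ i - c m i * eta ^+ i| <= D m.
Proof.
rewrite -mulrBl -coefB -comp_polyB normrM (ger0_norm (exprn_ge0 _ _)) //.
exact: normr_coef_le.
Qed.

Hypothesis eta_gt0 : 0 < eta.

Let coef_cvg i : c m i @[m --> \oo] --> s i.
Proof.
have cv := dominated_increments_cvg D_ge0 P_bounded (coef_inc i).
have e0 : eta ^+ i != 0 by rewrite gt_eqF // exprn_gt0.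
have -> : c^~ i = (fun m => (c m i * eta ^+ i) * (eta ^+ i)^-1).
  by apply/funext => m; rewrite mulfK.
suff : cvgn (fun m => c m i * eta ^+ i * (eta ^+ i)^-1).
  rewrite /s; have -> // : c^~ i = (fun m => (c m i * eta ^+ i) * (eta ^+ i)^-1).
  by apply/funext => m; rewrite mulfK.
by apply: is_cvgM => //; exact: is_cvg_cst.
Qed.

(** Uniform in [n]: keeping only the first [n] coefficients of an increment does not enlarge its l^1
    norm, so these partial sums also have increments below [D]. *)
Let coefs_dist n h m eps : `|h| <= eta ->
  (forall j, (m <= j)%N -> \sum_(k < j) D k - \sum_(k < m) D k <= eps) ->
  `|\sum_(i < n) s i * h ^+ i - \sum_(i < n) c m i * h ^+ i| <= eps.
Proof.
move=> heta De.
have cv : `|\sum_(i < n) c j i * h ^+ i - \sum_(i < n) c m i * h ^+ i|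
    @[j --> \oo] --> `|\sum_(i < n) s i * h ^+ i - \sum_(i < n) c m i * h ^+ i|.
  apply: cvg_norm; apply: cvgB; last exact: cvg_cst.
  apply: (@cvgn_sum_ord _ _ (fun i j => c j i * h ^+ i)
    (fun i => s i * h ^+ i)) => i.
  by apply: cvgM; [exact: coef_cvg | exact: cvg_cst].
rewrite -(cvg_lim (@Rhausdorff R) cv); apply: limr_le.
  by apply/cvg_ex; eexists; exact: cv.
exists m => // j /= mj; apply: le_trans (De j mj).
pose u j := \sum_(i < n) c j i * h ^+ i.
suff inc : forall p, `|u p.+1 - u p| <= D p.
  exact: (dominated_increments_dist inc mj).
move=> p.
rewrite /u -sumrB (le_trans (ler_norm_sum _ _ _)) //.
set Q := (P p.+1 - P p) \Po ('X + t%:P).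
have cE i : c p.+1 i * h ^+ i - c p i * h ^+ i = Q`_i * h ^+ i.
  by rewrite -mulrBl -coefB -comp_polyB.
rewrite /D /taylor_norm -/Q (@l1norm_widen _ _ _ (maxn n (size Q))) ?leq_maxr //.
rewrite (big_ord_widen _ (fun i => `|c p.+1 i * h ^+ i - c p i * h ^+ i|)
  (leq_maxl n (size Q))) big_mkcond.
apply: ler_sum => i _; case: ifP => _; last by rewrite mulr_ge0 ?exprn_ge0.
rewrite cE normrM normrX ler_wpM2l //.
by apply: lerXn2r; rewrite ?nnegrE.
Qed.

(** Once [n] exceeds the size of [P m], the [n]-th partial sum of its Taylor series is its exact
    value. Passing to the limit then costs at most [eps / 2] on either side. *)
Lemma poly_lim_pseries h : `|h| <= eta -> pseries s h @ \oo --> phi (t + h).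
Proof.
move=> heta; apply/cvgrPdist_le => eps e0.
have e2 : 0 < eps / 2 by rewrite divr_gt0.
have [m De] := dominated_increments_tail D_ge0 P_bounded e2.
exists (size (P m \Po ('X + t%:P))) => // n /= Pn.
have d1 := dominated_increments_lim D_ge0 P_bounded (horner_inc heta) De.
have d2 := coefs_dist n heta De.
have E : (P m).[t + h] = \sum_(i < n) c m i * h ^+ i.
  by rewrite -(horner_coef_wide _ Pn) horner_comp !hornerE (addrC t).
have -> : pseries s h n = \sum_(i < n) s i * h ^+ i.
  by rewrite /pseries /series /= big_mkord.
have := d1; have := d2; rewrite -E -/(phi _) !ler_norml => /andP[? ?] /andP[? ?].
apply/andP; split; lra.
Qed.

(** The linear coefficient of an increment, times [eta], is at most its norm. With [eta]
    proportional to [t] and [B = t^n], derivatives are controlled up to [O(t^(n - 1))], as needed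
    near [t = 0]. *)
Lemma poly_lim_derive_dist : `|s 1 - (P 0)^`().[t]| * eta <= B.
Proof.
have -> : (P 0)^`().[t] = c 0 1.
  rewrite /c -[_`_1]mulr1n -(coef_deriv _ 0).
  rewrite deriv_comp derivD derivX derivC addr0 mulr1 -horner_coef0 horner_comp.
  by rewrite !hornerE.
have cv : `|c m 1 - c 0 1| * eta @[m --> \oo] --> `|s 1 - c 0 1| * eta.
  apply: cvgM; last exact: cvg_cst.
  by apply: cvg_norm; apply: cvgB; [exact: coef_cvg | exact: cvg_cst].
rewrite -(cvg_lim (@Rhausdorff R) cv); apply: limr_le.
  by apply/cvg_ex; eexists; exact: cv.
exists 0%N => // j _ /=.
have := dominated_increments_dist (coef_inc 1) (leq0n j).
rewrite big_ord0 subr0 expr1 -mulrBl normrM (gtr0_norm eta_gt0).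
by move=> /le_trans; apply; exact: P_bounded.
Qed.

Lemma poly_lim_linear h : `|h| <= eta ->
  `|phi (t + h) - phi t - s 1 * h| <=
    (taylor_norm eta t (P 0) + B) * (`|h| / eta) ^+ 2.
Proof.
move=> heta.
have cvt : (P m).[t] @[m --> \oo] --> phi t.
  by rewrite -[t]addr0; apply: poly_lim_cvg; rewrite normr0.
have cv : `|(P m).[t + h] - (P m).[t] - c m 1 * h| @[m --> \oo] -->
    `|phi (t + h) - phi t - s 1 * h|.
  apply: cvg_norm; apply: cvgB; first by apply: cvgB => //; exact: poly_lim_cvg.
  by apply: cvgM; [exact: coef_cvg | exact: cvg_cst].
rewrite -(cvg_lim (@Rhausdorff R) cv); apply: limr_le.
  by apply/cvg_ex; eexists; exact: cv.
exists 0%N => // m _ /=.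
have := horner_sub_linear_le (P m \Po ('X + t%:P)) eta_gt0 heta.
rewrite !horner_comp !hornerD !hornerX !hornerC add0r (addrC h) => /le_trans; apply.
rewrite ler_wpM2r ?sqr_ge0 //; apply: (@le_trans _ _ (taylor_norm eta t (P 0) +
  \sum_(k < m) D k)); last by rewrite lerD2l; exact: P_bounded.
elim: m => [|m IH]; first by rewrite big_ord0 addr0.
have -> : P m.+1 = P m + (P m.+1 - P m) by ring.
rewrite comp_polyD (le_trans (l1normD _ _ eta_ge0)) // big_ord_recr /= addrA.
by rewrite lerD.
Qed.

End PolynomialLimits.

(** * Formal solution *)

Definition eqmodX (R : realType) (n : nat) (P Q : {poly R}) : Prop :=
  exists S, P = Q + 'X^n * S.

Section CongruenceModX.
Context {R : realType}.
Implicit Types (P Q A B : {poly R}).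

Lemma eqmodX_refl n P : eqmodX n P P.
Proof. by exists 0; rewrite mulr0 addr0. Qed.

Lemma eqmodX_trans n Q P A : eqmodX n P Q -> eqmodX n Q A -> eqmodX n P A.
Proof. by case=> S -> [S' ->]; exists (S + S'); ring. Qed.

Lemma eqmodXD n P Q A B :
  eqmodX n P Q -> eqmodX n A B -> eqmodX n (P + A) (Q + B).
Proof. by case=> S -> [S' ->]; exists (S + S'); ring. Qed.

Lemma eqmodXN n P Q : eqmodX n P Q -> eqmodX n (- P) (- Q).
Proof. by case=> S ->; exists (- S); ring. Qed.

Lemma eqmodXM n P Q A B :
  eqmodX n P Q -> eqmodX n A B -> eqmodX n (P * A) (Q * B).
Proof.
case=> S -> [S' ->]; exists (S * B + Q * S' + 'X^n * S * S'); ring.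
Qed.

Lemma eqmodXX n P Q k : eqmodX n P Q -> eqmodX n (P ^+ k) (Q ^+ k).
Proof.
move=> PQ; elim: k => [|k IH]; first by rewrite !expr0; exact: eqmodX_refl.
by rewrite !exprS; exact: eqmodXM.
Qed.

Lemma eqmodX_sum n (I : Type) (s : seq I) (F H : I -> {poly R}) :
  (forall i, eqmodX n (F i) (H i)) ->
  eqmodX n (\sum_(i <- s) F i) (\sum_(i <- s) H i).
Proof.
by move=> FH; apply: big_rec2 => [|i P Q _]; [exact: eqmodX_refl|exact: eqmodXD].
Qed.

Lemma eqmodX_shift n k P Q : eqmodX n P Q -> eqmodX (k + n) ('X^k * P) ('X^k * Q).
Proof. by case=> S ->; exists S; rewrite exprD; ring. Qed.

Lemma eqmodX_comp n P A B : eqmodX n A B -> eqmodX n (P \Po A) (P \Po B).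
Proof.
move=> AB; elim/poly_ind: P => [|P x IH].
  by rewrite !comp_poly0; exact: eqmodX_refl.
rewrite !comp_poly_MXaddC; apply: eqmodXD; last exact: eqmodX_refl.
exact: eqmodXM.
Qed.

Lemma eqmodX1 P : eqmodX 1 P (P`_0)%:P.
Proof.
rewrite -comp_poly0r -{1}(comp_polyXr P); apply: eqmodX_comp.
by exists 1; rewrite expr1 mulr1 add0r.
Qed.

Lemma eqmodX1_comp P A : eqmodX 1 (P \Po ('X * A)) (P`_0)%:P.
Proof.
rewrite -comp_poly0r; apply: eqmodX_comp.
by exists A; rewrite expr1 add0r.
Qed.

(** First-order binomial expansion: since [n > 0], products of two [X^n] vanish modulo [X^(n + 1)],
    and next to [X^n] the polynomial [P] counts only through its constant coefficient. For [i = 0]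
    the truncated predecessor is harmless, being multiplied by [i]. *)
Lemma eqmodX_addXn_exp n (P : {poly R}) (x a : R) i : (0 < n)%N -> P`_0 = x ->
  eqmodX n.+1 ((P + a%:P * 'X^n) ^+ i)
    (P ^+ i + (i%:R * x ^+ i.-1 * a)%:P * 'X^n).
Proof.
move=> n0 Px; elim: i => [|i IH].
  by rewrite !expr0 !mul0r addr0; exact: eqmodX_refl.
rewrite exprSr; apply: (eqmodX_trans (eqmodXM IH (eqmodX_refl _ _))).
have [S PS] : eqmodX 1 P x%:P by rewrite -Px; exact: eqmodX1.
have [S' PS'] : eqmodX 1 (P ^+ i) (x ^+ i)%:P.
  by rewrite polyC_exp; apply: eqmodXX; exists S.
have Xn : 'X^n = 'X * 'X^(n.-1) :> {poly R} by rewrite -exprS prednK.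
exists ((i%:R * x ^+ i.-1 * a)%:P * (a%:P * 'X^(n.-1) + S) + a%:P * S').
have -> : i.+1%:R * x ^+ i.+1.-1 * a = i%:R * x ^+ i.-1 * a * x + a * x ^+ i.
  case: i {IH PS'} => [|i] /=; first by rewrite !expr0; ring.
  by rewrite -addn1 natrD exprS; ring.
set z := i%:R * x ^+ i.-1 * a.
rewrite exprSr; set Q := P ^+ i in PS' *; set xi := x ^+ i in PS' *.
have -> : (Q + z%:P * 'X^n) * (P + a%:P * 'X^n) = Q * P + (z%:P * 'X^n * P +
  a%:P * 'X^n * Q + z%:P * a%:P * ('X^n * 'X^n)) by ring.
rewrite -!addrA; congr (_ + _); rewrite PS PS' expr1 exprS polyCD !polyCM {3}Xn.
by ring.
Qed.

End CongruenceModX.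

(** * Order-by-order solution of the invariance equation *)

Section FormalSolution.
Context {R : realType}.
Variables (kappa q : nat) (c r y0 : R) (C : nat -> nat -> R) (m : nat).

Definition weight i j := (kappa * i + (kappa + q) * j)%N.

(** The inner map divided by its variable; with [q = N - 1], the scalars [r] and [d] are the
    coefficients of degrees [N] and [2 N - 1]. *)
Definition inner_factor (d : R) : {poly R} :=
  1 + r%:P * 'X^q + d%:P * 'X^(2 * q).

(** The truncation of [f (t^kappa X, t^(kappa + q) Y)], divided by [t^(kappa + 2 q)]. The natural
    subtraction in the exponent is exact wherever [C i j] is nonzero, by [C_weight]. *)
Definition scaled_map (X Y : {poly R}) : {poly R} :=
  \sum_(i < m) \sum_(j < m)
    (C i j)%:P * 'X^(weight i j - (kappa + 2 * q)) * (X ^+ i * Y ^+ j).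

(** The first component of the invariance defect for [K = (t^kappa X, t^(kappa + q) Y)], divided by
    [t^kappa]; [errY] is the second one, divided by [t^(kappa + q)]. The powers of [inner_factor]
    come from composing the extracted powers of [t] with the inner map. *)
Definition errX (X Y : {poly R}) (d : R) : {poly R} :=
  X + c%:P * 'X^q * Y
  - inner_factor d ^+ kappa * (X \Po ('X * inner_factor d)).

Definition errY (X Y : {poly R}) (d : R) : {poly R} :=
  Y + 'X^q * scaled_map X Y
  - inner_factor d ^+ (kappa + q) * (Y \Po ('X * inner_factor d)).

Definition lead_sum (E : nat -> nat -> R) : R :=
  \sum_(i < m) \sum_(j < m)
    if weight i j == (kappa + 2 * q)%N then C i j * E i j else 0.

(** The lowest-weight part of [f] at [(1, y0)], followed by its partial derivatives in [x] and in
    [y] there. *)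
Let f0 := lead_sum (fun i j => y0 ^+ j).
Let f1 := lead_sum (fun i j => i%:R * y0 ^+ j).
Let f2 := lead_sum (fun i j => j%:R * y0 ^+ j.-1).

Hypotheses (q_gt0 : (0 < q)%N) (kappa_gt0 : (0 < kappa)%N).
Hypothesis C_weight : forall i j, C i j != 0 -> (kappa + 2 * q <= weight i j)%N.

Lemma inner_factor_exp d p :
  eqmodX q.+1 (inner_factor d ^+ p) (1 + (p%:R * r)%:P * 'X^q).
Proof.
have := @eqmodX_addXn_exp _ q 1 1 r p q_gt0.
rewrite coefC eqxx => /(_ erefl); rewrite !expr1n mulr1 => h.
apply: eqmodX_trans h; apply: eqmodXX; rewrite /inner_factor.
exists (d%:P * 'X^(q.-1)); congr (_ + _).
have -> : (2 * q = q.+1 + q.-1)%N by lia.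
by rewrite exprD; ring.
Qed.

(** Monomials above the lowest weight carry an extra factor [X], so a perturbation of order [n]
    reaches them only at order [n + 1]; what remains is the differential of the leading part at
    [(1, y0)]. *)
Lemma scaled_map_addXn (X Y : {poly R}) n (a b : R) :
  (0 < n)%N -> X`_0 = 1 -> Y`_0 = y0 ->
  eqmodX n.+1 (scaled_map (X + a%:P * 'X^n) (Y + b%:P * 'X^n))
    (scaled_map X Y + (f1 * a + f2 * b)%:P * 'X^n).
Proof.
move=> n0 X0 Y0.
have -> : (f1 * a + f2 * b)%:P * 'X^n = \sum_(i < m) \sum_(j < m)
    (if weight i j == (kappa + 2 * q)%N then
       C i j * (i%:R * y0 ^+ j) * a + C i j * (j%:R * y0 ^+ j.-1) * b
     else 0)%:P * 'X^n.
  rewrite /f1 /f2 /lead_sum !mulr_suml -big_split /= rmorph_sum mulr_suml.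
  apply: eq_bigr => i _; rewrite !mulr_suml -big_split /= rmorph_sum mulr_suml.
  apply: eq_bigr => j _; case: ifP => _; first reflexivity.
  rewrite (mul0r a) (mul0r b) addr0. reflexivity.
rewrite /scaled_map -big_split /=; apply: eqmodX_sum => i.
rewrite -big_split /=; apply: eqmodX_sum => j.
have [->|Cij] := eqVneq (C i j) 0.
  by rewrite !mul0r addr0 if_same polyC0 !mul0r addr0; exact: eqmodX_refl.
have [S HS] := eqmodXM (eqmodX_addXn_exp a i n0 X0) (eqmodX_addXn_exp b j n0 Y0).
rewrite expr1n mulr1 in HS.
case: eqP => [w0|/eqP w0]; last first.
  have -> : (weight i j - (kappa + 2 * q) =
    (weight i j - (kappa + 2 * q)).-1.+1)%N by have := C_weight Cij; lia.
  set w := (_ - _).-1; rewrite mul0r addr0 HS !exprS.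
  set A := X ^+ i; set B := Y ^+ j; set x := (i%:R * a)%:P;
  set y := (j%:R * y0 ^+ j.-1 * b)%:P.
  exists ((C i j)%:P * 'X^w * (A * y + x * B + x * y * 'X^n + 'X * S)).
  by rewrite exprS; ring.
have [S1 HX] : eqmodX 1 (X ^+ i) 1.
  by have := eqmodXX i (eqmodX1 X); rewrite X0 polyC1 expr1n.
have [S2 HY] : eqmodX 1 (Y ^+ j) (y0 ^+ j)%:P.
  by have := eqmodXX j (eqmodX1 Y); rewrite Y0 polyC_exp.
rewrite w0 subnn expr0 mulr1 HS.
have Xn : 'X^n = 'X * 'X^(n.-1) :> {poly R} by rewrite -exprS prednK.
set A := X ^+ i in HX *; set B := Y ^+ j in HY *.
rewrite polyCD !polyCM.
set u := i%:R%:P; set v := j%:R%:P; set Cp := (C i j)%:P.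
set yj := (y0 ^+ j)%:P in HY *; set yj1 := (y0 ^+ j.-1)%:P.
exists (Cp * (u * a%:P * S2 + v * yj1 * b%:P * S1 +
  u * a%:P * (v * yj1 * b%:P) * 'X^(n.-1) + S)).
have -> : Cp * ((A + u * a%:P * 'X^n) * (B + v * yj1 * b%:P * 'X^n) + 'X^(n.+1) * S)
  = Cp * (A * B) + Cp * (u * a%:P * B * 'X^n + v * yj1 * b%:P * A * 'X^n +
    u * a%:P * (v * yj1 * b%:P) * ('X^n * 'X^n) + 'X^(n.+1) * S) by ring.
rewrite -!addrA; congr (_ + _); rewrite exprS HX HY expr1.
have -> : 'X^n * 'X^n = 'X * 'X^(n.-1) * 'X^n :> {poly R} by rewrite -Xn.
by ring.
Qed.

Hypotheses (r_lt0 : r < 0) (c_gt0 : 0 < c).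
Hypothesis cy0 : c * y0 = kappa%:R * r.
Hypothesis f0E : f0 = (kappa + q)%:R * y0 * r.
Hypothesis rf2 : r * q.+1%:R <= f2.

(** Euler's identity for a quasi-homogeneous function, at the point [(1, y0)]. It eliminates [f1]
    from the linear systems below. *)
Lemma lead_sum_euler :
  kappa%:R * f1 + (kappa + q)%:R * y0 * f2 = (kappa + 2 * q)%:R * f0.
Proof.
rewrite /f0 /f1 /f2 /lead_sum !mulr_sumr -big_split /=; apply: eq_bigr => i _.
rewrite !mulr_sumr -big_split /=; apply: eq_bigr => j _.
case: eqP => [<-|_]; last by rewrite !mulr0 addr0.
rewrite /weight (natrD _ (kappa * i)) !natrM.
case: (nat_of_ord j) => [|p] /=; first by rewrite expr0; ring.
by rewrite exprS; ring.
Qed.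

(* The determinant of the linear system at order n is
   r (n - q) (r (2 kappa + n + 2 q) - f2); it vanishes only at the resonance
   n = q, where the extra coefficient d of the inner map is used. *)
Lemma order_equation_solvable n (e1 e2 : R) : (0 < n)%N ->
  exists a b d : R, [/\ d = 0 \/ n = q,
    e1 + c * b - a * (kappa + n)%:R * r - kappa%:R * d = 0 &
    e2 + (f1 * a + f2 * b) - b * (kappa + q + n)%:R * r
      - (kappa + q)%:R * y0 * d = 0].
Proof.
move=> n0; have k0 : (0 : R) < kappa%:R by rewrite ltr0n.
have q0 : (0 : R) < q%:R by rewrite ltr0n.
have n0' : (0 : R) < n%:R by rewrite ltr0n.
have cN0 : c != 0 by rewrite gt_eqF.
have kN0 : (kappa%:R : R) != 0 by rewrite gt_eqF.
have rN0 : r != 0 by rewrite lt_eqF.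
have y0E : y0 = kappa%:R * r / c by rewrite -cy0; field.
(* Euler's identity with [f0E] and [cy0] expresses [f1] through [f2]; this is what makes the
   determinant factor. *)
have cf1 : c * f1 = (kappa + q)%:R * r * ((kappa + 2 * q)%:R * r - f2).
  have := lead_sum_euler; rewrite f0E y0E => h.
  apply: (mulfI kN0).
  rewrite mulrCA (_ : kappa%:R * f1 = (kappa + 2 * q)%:R * ((kappa + q)%:R *
    (kappa%:R * r / c) * r) - (kappa + q)%:R * (kappa%:R * r / c) * f2);
    last by rewrite -h; ring.
  by field.
(* The slope hypothesis [rf2] is used here only: as [r < 0], the second factor of the determinant is
   negative beyond [q + 1]. *)
have neg (x : R) : q.+1%:R < x -> r * x - f2 < 0.
  move=> qx; rewrite subr_lt0; apply: lt_le_trans rf2.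
  by rewrite ltr_nM2l.
have [nq|nq] := eqVneq n q.
  rewrite nq; set D := r * (2 * kappa%:R + 3 * q%:R) - f2.
  (* At the resonance [a] is set to [0]; the first equation eliminates [d], and [- D] is then the
     coefficient of [b] in the second one. *)
  have D0 : D != 0.
    by rewrite lt_eqF // neg // -!natrM -natrD ltr_nat; lia.
  exists 0, ((- e1 * (kappa + q)%:R * r / c + e2) / D).
  exists ((e1 + c * ((- e1 * (kappa + q)%:R * r / c + e2) / D)) / kappa%:R).
  split; [by right|by field; rewrite D0 cN0 kN0|].
  by move: D0; rewrite /D y0E !natrD => D0; field; rewrite D0 cN0 kN0.
set D := r * (n%:R - q%:R) * (r * (2 * kappa%:R + n%:R + 2 * q%:R) - f2).
have D0 : D != 0.
  rewrite /D !mulf_neq0 //; first by rewrite subr_eq0 eqr_nat.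
  by rewrite lt_eqF // neg // -!natrM -!natrD ltr_nat; lia.
exists ((c * e2 - e1 * (f2 - (kappa + q + n)%:R * r)) / D).
exists (((kappa + n)%:R * r * e2 + f1 * e1) / D), 0; split; first by left.
  have DE : D = - (kappa + n)%:R * r * (f2 - (kappa + q + n)%:R * r) - c * f1.
    by rewrite cf1 /D (natrD _ kappa (2 * q)) natrM !natrD; ring.
  apply: (mulfI D0); rewrite mulr0 mulr0 subr0.
  have -> : D * (e1 + c * (((kappa + n)%:R * r * e2 + f1 * e1) / D) -
    (c * e2 - e1 * (f2 - (kappa + q + n)%:R * r)) / D * (kappa + n)%:R * r) =
    D * e1 + c * ((kappa + n)%:R * r * e2 + f1 * e1) -
    (c * e2 - e1 * (f2 - (kappa + q + n)%:R * r)) * (kappa + n)%:R * r by field.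
  by rewrite DE; ring.
have DE : D = - (kappa + n)%:R * r * (f2 - (kappa + q + n)%:R * r) - c * f1.
  by rewrite cf1 /D (natrD _ kappa (2 * q)) natrM !natrD; ring.
apply: (mulfI D0); rewrite mulr0 mulr0 subr0.
have -> : D * (e2 + (f1 * ((c * e2 - e1 * (f2 - (kappa + q + n)%:R * r)) / D) +
    f2 * (((kappa + n)%:R * r * e2 + f1 * e1) / D)) -
    ((kappa + n)%:R * r * e2 + f1 * e1) / D * (kappa + q + n)%:R * r) =
    D * e2 + f1 * (c * e2 - e1 * (f2 - (kappa + q + n)%:R * r)) +
    f2 * ((kappa + n)%:R * r * e2 + f1 * e1) -
    ((kappa + n)%:R * r * e2 + f1 * e1) * (kappa + q + n)%:R * r by field.
by rewrite DE; ring.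
Qed.

(** Composition turns [a X^n] into [a X^n] times a power of the inner factor, whose first correction
    sits at order [n + q]. A change [d0] occurs only for [n = q], when [2 q = n + q]: it acts at
    exactly that order through the outer power, whereas inside [Z] it carries one more factor
    [X]. *)
Lemma inner_comp_addXn (Z : {poly R}) p n (a d d0 : R) : d0 = 0 \/ n = q ->
  eqmodX (n + q).+1
    (inner_factor (d + d0) ^+ p *
      ((Z + a%:P * 'X^n) \Po ('X * inner_factor (d + d0))))
    (inner_factor d ^+ p * (Z \Po ('X * inner_factor d)) + a%:P * 'X^n +
      (a * (p + n)%:R * r + p%:R * Z`_0 * d0)%:P * 'X^(n + q)).
Proof.
move=> d0n; set G' := inner_factor (d + d0); set G := inner_factor d.
have -> : G' ^+ p * ((Z + a%:P * 'X^n) \Po ('X * G')) =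
    G' ^+ p * (Z \Po ('X * G')) + 'X^n * (a%:P * G' ^+ (p + n)).
  rewrite comp_polyD comp_polyM comp_polyC comp_Xn_poly exprMn exprD.
  by ring.
have h2 : eqmodX (n + q).+1 ('X^n * (a%:P * G' ^+ (p + n)))
    ('X^n * (a%:P * (1 + ((p + n)%:R * r)%:P * 'X^q))).
  rewrite -addnS; apply: eqmodX_shift; apply: eqmodXM; first exact: eqmodX_refl.
  exact: inner_factor_exp.
have h1 : eqmodX (n + q).+1 (G' ^+ p * (Z \Po ('X * G')))
    (G ^+ p * (Z \Po ('X * G)) + 'X^(n + q) * (p%:R * Z`_0 * d0)%:P).
  case: d0n => [d00|nq].
    rewrite d00 mulr0 polyC0 mulr0 addr0 /G' d00 addr0; exact: eqmodX_refl.
  have n2q : (n + q = 2 * q)%N by rewrite nq mul2n addnn.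
  have G'E : G' = G + d0%:P * 'X^(n + q).
    by rewrite /G' /G /inner_factor n2q polyCD; ring.
  have G0 : G`_0 = 1.
    rewrite /G /inner_factor !coefD !coefCM !coefXn coef1 eqxx.
    have [-> ->] : (0%N == q) = false /\ (0%N == 2 * q)%N = false by split; lia.
    by rewrite !mulr0 !addr0.
  have nq0 : (0 < n + q)%N by rewrite addn_gt0 q_gt0 orbT.
  have Gp : eqmodX (n + q).+1 (G' ^+ p)
      (G ^+ p + (p%:R * 1 ^+ p.-1 * d0)%:P * 'X^(n + q)).
    by rewrite G'E; exact: eqmodX_addXn_exp.
  have GZ : eqmodX (n + q).+1 (Z \Po ('X * G')) (Z \Po ('X * G)).
    apply: eqmodX_comp; exists d0%:P; rewrite G'E exprS; ring.
  apply: (eqmodX_trans (eqmodXM Gp GZ)).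
  rewrite expr1n mulr1 mulrDl; apply: eqmodXD; first exact: eqmodX_refl.
  rewrite mulrAC mulrC -addn1; apply: eqmodX_shift.
  rewrite mulrAC [X in eqmodX _ _ X]polyCM; apply: eqmodXM.
    exact: eqmodX_refl.
  exact: eqmodX1_comp.
apply: (eqmodX_trans (eqmodXD h1 h2)).
exists 0; rewrite mulr0 addr0 !polyCD !polyCM exprD; ring.
Qed.

Lemma eqmodX_lead n (P : {poly R}) : eqmodX n P 0 ->
  exists e, eqmodX n.+1 P (e%:P * 'X^n).
Proof.
case=> S ->; exists S`_0; rewrite add0r mulrC -[X in eqmodX X]addn1.
by rewrite mulrC; rewrite [X in eqmodX _ _ X]mulrC; apply: eqmodX_shift; exact: eqmodX1.
Qed.

(** After scaling, both the map and the inner map are the identity up to order [q]. A coefficient of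
    order [n] therefore cancels at order [n] of the errors and is first seen at order [n + q], hence
    the shift by [q]. *)
Lemma formal_solution n : (0 < n)%N -> exists (X Y : {poly R}) (d : R),
  [/\ X`_0 = 1, Y`_0 = y0, eqmodX (n + q) (errX X Y d) 0 &
      eqmodX (n + q) (errY X Y d) 0].
Proof.
case: n => // n _; elim: n => [|n [X [Y [d [X0 Y0 EX EY]]]]].
  (* The constants [1] and [y0] suffice to start: [cy0] and [f0E] say that the coefficients of [X^q]
     in the errors vanish. *)
  exists 1, y0%:P, 0; rewrite coef1 coefC !eqxx; split=> //.
    rewrite add1n /errX -polyC1 comp_polyC polyC1 mulr1.
    have [S ->] := inner_factor_exp 0 kappa; rewrite -cy0.
    by exists (- S); rewrite !polyCM; ring.
  rewrite add1n /errY comp_polyC.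
  have [S ->] := inner_factor_exp 0 (kappa + q).
  have [S' HS'] : eqmodX 1 (scaled_map 1 y0%:P) (f0%:P).
    have -> : f0 = (scaled_map 1 y0%:P)`_0; last exact: eqmodX1.
    rewrite /f0 /lead_sum /scaled_map coef_sum; apply: eq_bigr => i _.
    rewrite coef_sum; apply: eq_bigr => j _.
    rewrite expr1n mul1r -rmorphXn /= coefMC coefCM coefXn.
    have [->|Cij] := eqVneq (C i j) 0; first by rewrite !mul0r if_same.
    have -> : (0%N == weight i j - (kappa + 2 * q))%N =
      (weight i j == kappa + 2 * q)%N by have := C_weight Cij; lia.
    by case: eqP; rewrite ?mulr1 ?mulr0 ?mul0r.
  rewrite HS' f0E; exists (S' - S * y0%:P); rewrite !polyCM expr1 exprS.
  by ring.
have [e1 HX] := eqmodX_lead EX; have [e2 HY] := eqmodX_lead EY.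
have [a [b [d0 [d0n eq1 eq2]]]] := order_equation_solvable e1 e2 (ltn0Sn n).
exists (X + a%:P * 'X^(n.+1)), (Y + b%:P * 'X^(n.+1)), (d + d0).
rewrite !coefD !coefCM !coefXn !mulr0 !addr0; split=> //; rewrite addSn.
  have h := inner_comp_addXn X kappa a d d0n.
  rewrite /errX; apply: (eqmodX_trans (eqmodXD (eqmodX_refl _ _) (eqmodXN h))).
  rewrite X0.
  have -> : 0 = e1%:P * 'X^(n.+1 + q) - (e1%:P * 'X^(n.+1 + q)) :> {poly R} by ring.
  have -> : X + a%:P * 'X^(n.+1) + c%:P * 'X^q * (Y + b%:P * 'X^(n.+1)) -
      (inner_factor d ^+ kappa * (X \Po 'X * inner_factor d) + a%:P * 'X^(n.+1) +
      (a * (kappa + n.+1)%:R * r + kappa%:R * 1 * d0)%:P * 'X^(n.+1 + q)) =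
      errX X Y d + (c * b - a * (kappa + n.+1)%:R * r - kappa%:R * d0)%:P
        * 'X^(n.+1 + q).
    by rewrite /errX mulr1 !polyCD !polyCN !polyCM (exprD _ n.+1 q); ring.
  apply: eqmodXD => //.
  have -> : c * b - a * (kappa + n.+1)%:R * r - kappa%:R * d0 = - e1.
    by apply/eqP; rewrite -addr_eq0 -eq1; apply/eqP; ring.
  by rewrite polyCN mulNr; exact: eqmodX_refl.
have h := inner_comp_addXn Y (kappa + q) b d d0n.
have hs := scaled_map_addXn a b (ltn0Sn n) X0 Y0.
have {}hs : eqmodX (n.+1 + q).+1
    ('X^q * scaled_map (X + a%:P * 'X^(n.+1)) (Y + b%:P * 'X^(n.+1)))
    ('X^q * (scaled_map X Y + (f1 * a + f2 * b)%:P * 'X^(n.+1))).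
  by rewrite addnC -addnS; exact: eqmodX_shift.
rewrite /errY; apply: (eqmodX_trans (eqmodXD
  (eqmodXD (eqmodX_refl _ _) hs) (eqmodXN h))).
rewrite Y0.
have -> : 0 = e2%:P * 'X^(n.+1 + q) - (e2%:P * 'X^(n.+1 + q)) :> {poly R} by ring.
set F1 := f1; set F2 := f2.
have -> : Y + b%:P * 'X^(n.+1) + 'X^q *
    (scaled_map X Y + (F1 * a + F2 * b)%:P * 'X^(n.+1)) -
    (inner_factor d ^+ (kappa + q) * (Y \Po 'X * inner_factor d) +
     b%:P * 'X^(n.+1) + (b * (kappa + q + n.+1)%:R * r +
       (kappa + q)%:R * y0 * d0)%:P * 'X^(n.+1 + q)) =
    errY X Y d + ((F1 * a + F2 * b) - b * (kappa + q + n.+1)%:R * r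
      - (kappa + q)%:R * y0 * d0)%:P * 'X^(n.+1 + q).
  by rewrite /errY !polyCD !polyCN !polyCM (exprD _ n.+1 q); ring.
apply: eqmodXD => //.
have -> : F1 * a + F2 * b - b * (kappa + q + n.+1)%:R * r -
    (kappa + q)%:R * y0 * d0 = - e2.
  by apply/eqP; rewrite -addr_eq0 -eq2 /F1 /F2; apply/eqP; ring.
by rewrite polyCN mulNr; exact: eqmodX_refl.
Qed.

End FormalSolution.

(** * Sectorial norms and the inner map *)

Definition sector_norm (R : realType) (theta t : R) (P : {poly R}) : R :=
  taylor_norm (theta * t) t P.

Section SectorNorm.
Context {R : realType}.
Implicit Types (P Q : {poly R}).
Variables (theta t : R).
Hypotheses (theta_ge0 : 0 <= theta) (t_ge0 : 0 <= t).

Let eta_ge0 : 0 <= theta * t. Proof. exact: mulr_ge0. Qed.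
Let nu := sector_norm theta t.

Lemma sector_norm_ge0 P : 0 <= nu P.
Proof. exact: l1norm_ge0. Qed.

Lemma sector_normD P Q : nu (P + Q) <= nu P + nu Q.
Proof. by rewrite /nu /sector_norm /taylor_norm comp_polyD l1normD. Qed.

Lemma sector_normB P Q : nu (P - Q) <= nu P + nu Q.
Proof. by rewrite /nu /sector_norm /taylor_norm comp_polyB l1normB. Qed.

Lemma sector_normM P Q : nu (P * Q) <= nu P * nu Q.
Proof. by rewrite /nu /sector_norm /taylor_norm comp_polyM l1normM. Qed.

Lemma sector_normC x : nu x%:P = `|x|.
Proof. by rewrite /nu /sector_norm /taylor_norm comp_polyC l1normC. Qed.

Lemma sector_norm_exp P i : nu (P ^+ i) <= nu P ^+ i.
Proof.
rewrite /nu /sector_norm /taylor_norm.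
have -> : (P ^+ i) \Po ('X + t%:P) = (P \Po ('X + t%:P)) ^+ i.
  elim: i => [|i IH]; first by rewrite !expr0 -[1]/(1%:P) comp_polyC.
  by rewrite !exprS comp_polyM IH.
exact: l1norm_exp.
Qed.

Lemma sector_norm_sum (I : Type) (s : seq I) (F : I -> {poly R}) :
  nu (\sum_(i <- s) F i) <= \sum_(i <- s) nu (F i).
Proof.
elim/big_rec2: _ => [|i x P _ le_Px].
  by rewrite -[0]/(0%:P) sector_normC normr0.
by rewrite (le_trans (sector_normD _ _)) // lerD2l.
Qed.

Lemma sector_norm_le_l1norm P : nu P <= l1norm ((1 + theta) * t) P.
Proof.
rewrite (le_trans (l1norm_comp _ _ eta_ge0)) // l1norm_le ?l1norm_ge0 //.
rewrite (le_trans (l1normD _ _ eta_ge0)) // l1normC -['X]expr1 l1normXn expr1.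
rewrite ger0_norm //; lra.
Qed.

(** The hypothesis says, in the l^1 sense, that [F] maps the disc of radius [theta t] about [t] into
    the disc of radius [theta F(t)] about [F(t)]. *)
Lemma sector_norm_comp P (F : {poly R}) : 0 <= F.[t] ->
  l1norm (theta * t) ((F \Po ('X + t%:P)) - (F.[t])%:P) <= theta * F.[t] ->
  nu (P \Po F) <= sector_norm theta F.[t] P.
Proof.
move=> F0 Fc; rewrite /nu /sector_norm /taylor_norm.
set G := _ - _ in Fc.
have -> : (P \Po F) \Po ('X + t%:P) = (P \Po ('X + (F.[t])%:P)) \Po G.
  rewrite -!comp_polyA; congr (_ \Po _).
  by rewrite comp_polyD comp_polyX comp_polyC /G subrK.
by rewrite (le_trans (l1norm_comp _ _ eta_ge0)) // l1norm_le ?l1norm_ge0.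
Qed.

Lemma sector_norm_subX P Q (x : R) i : nu P <= x -> nu Q <= x ->
  nu (P ^+ i - Q ^+ i) <= i%:R * x ^+ i.-1 * nu (P - Q).
Proof.
move=> Px Qx; have x0 : 0 <= x by apply: le_trans Px; exact: sector_norm_ge0.
elim: i => [|i IH].
  by rewrite !expr0 subrr -[0]/(0%:P) sector_normC normr0 !mul0r.
have -> : P ^+ i.+1 - Q ^+ i.+1 = P * (P ^+ i - Q ^+ i) + Q ^+ i * (P - Q).
  by rewrite !exprS; ring.
apply: (le_trans (sector_normD _ _)).
apply: (@le_trans _ _ (x * (i%:R * x ^+ i.-1 * nu (P - Q)) + x ^+ i * nu (P - Q))).
  apply: lerD; apply: (le_trans (sector_normM _ _)).
    by apply: ler_pM => //; exact: sector_norm_ge0.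
  apply: ler_wpM2r; first exact: sector_norm_ge0.
  apply: (le_trans (sector_norm_exp _ _)).
  by apply: lerXn2r; rewrite ?nnegrE //; exact: sector_norm_ge0.
case: i {IH} => [|i] /=; first by rewrite expr0; lra.
by rewrite -[i.+2%:R]natr1 exprS le_eqVlt; apply/orP; left; apply/eqP; ring.
Qed.

End SectorNorm.

(** * Invariance of small sectors under the inner map *)

Section InnerMap.
Context {R : realType}.
Variables (q : nat) (r : R).
Hypotheses (q_gt0 : (0 < q)%N) (r_lt0 : r < 0).

(** Chosen so that [4^(q + 1) theta = 1 / 2]: the second-order part of the translate of
    [r X^(q + 1)] then costs only [- r t^q / 2] relative to [theta t]. *)
Let theta : R := (2 * 4 ^+ q.+1)^-1.

Lemma l1norm_translate_remainder (h t : R) N : 0 <= h -> h <= 1 -> 0 <= t ->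
  l1norm (h * t) (('X + t%:P) ^+ N - (t ^+ N)%:P - (N%:R * t ^+ N.-1)%:P * 'X)
    <= 4 ^+ N * h ^+ 2 * t ^+ N.
Proof.
move=> h0 h1 t0; have e0 : 0 <= h * t by exact: mulr_ge0.
elim: N => [|N IH].
  rewrite !expr0 (_ : _ - _ = 0%:P); last first.
    by rewrite mulr1 mulr0n polyC0 polyC1; ring.
  by rewrite l1normC normr0 mulr1 mul1r sqr_ge0.
set A := _ - _ - _ in IH.
have -> : ('X + t%:P) ^+ N.+1 - (t ^+ N.+1)%:P - (N.+1%:R * t ^+ N)%:P * 'X =
    A * ('X + t%:P) + (N%:R * t ^+ N.-1)%:P * 'X^2.
  rewrite /A -natr1 mulrDl mul1r !exprS.
  case: N {IH A} => [|N] /=.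
    by rewrite !expr0 !mulr1 mulr0n add0r polyC0 polyC1; ring.
  by rewrite !exprS !polyCD !polyCM; ring.
apply: (le_trans (l1normD _ _ e0)).
apply: (@le_trans _ _ (4 ^+ N * h ^+ 2 * t ^+ N * (h * t + t) +
    N%:R * t ^+ N.-1 * (h * t) ^+ 2)).
  apply: lerD; apply: (le_trans (l1normM _ _ e0)).
    apply: ler_pM; rewrite ?l1norm_ge0 //.
    apply: (le_trans (l1normD _ _ e0)).
    by rewrite l1normC -['X]expr1 l1normXn expr1 ger0_norm.
  by rewrite l1normC l1normXn ger0_norm // mulr_ge0 // exprn_ge0.
have -> : 4 ^+ N * h ^+ 2 * t ^+ N * (h * t + t) + N%:R * t ^+ N.-1 * (h * t) ^+ 2
  = (4 ^+ N * (h + 1) + N%:R) * (h ^+ 2 * t ^+ N.+1).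
  by case: N {IH A} => [|N] /=; rewrite ?exprS; ring.
rewrite -mulrA ler_wpM2r ?mulr_ge0 ?exprn_ge0 //.
have N4 : N%:R <= 4 ^+ N :> R by rewrite -natrX ler_nat ltnW // ltn_expl.
have : 4 ^+ N * h <= 4 ^+ N * 1 :> R by rewrite ler_wpM2l // exprn_ge0.
by have := ler0n R N; rewrite exprS; lra.
Qed.

Definition inner_map (d : R) : {poly R} := 'X * inner_factor q r d.

Lemma horner_inner_map d t :
  (inner_map d).[t] = t * (1 + r * t ^+ q + d * (t ^+ q) ^+ 2).
Proof.
rewrite /inner_map /inner_factor hornerM hornerX !hornerD !hornerM !hornerXn.
by rewrite !hornerC mulnC exprM.
Qed.

(** A reverse Bernoulli inequality: as long as [n y <= 1], half of the linear decrease survives. *)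
Lemma pow_one_sub_le (y : R) n : 0 <= y -> n%:R * y <= 1 -> y <= 1 ->
  (1 - y) ^+ n <= 1 - n%:R * y / 2.
Proof.
move=> y0 + y1; elim: n => [|n IH]; first by rewrite expr0 !mul0r subr0.
rewrite -natr1 mulrDl mul1r exprS => ny.
have {}IH := IH ltac:(lra).
have n0 : 0 <= n%:R * y by rewrite mulr_ge0.
apply: (@le_trans _ _ ((1 - y) * (1 - n%:R * y / 2))).
  by rewrite ler_wpM2l // subr_ge0.
set z := n%:R * y in ny IH n0 *; have : y * z <= y * 1 by rewrite ler_wpM2l //; lra.
lra.
Qed.

Let theta_gt0 : 0 < theta.
Proof. by rewrite invr_gt0 mulr_gt0 ?exprn_gt0. Qed.

Let theta_le1 : theta <= 1.
Proof.
rewrite invf_le1 ?mulr_gt0 ?exprn_gt0 // -natrX -natrM ler1n.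
by rewrite muln_gt0 expn_gt0.
Qed.

(** With [tau = t^q], the derivative of the inner map is about [1 + (q + 1) r tau], its value about
    [t (1 + r tau)]. The gap [- q r tau >= - r tau] pays for the quadratic remainder and for the [d]
    term, which gives the last bound. In the power bound the [d] term costs one half of the decrease
    and [pow_one_sub_le] another half, hence the [4]. *)
Lemma inner_map_bounds (d : R) (n : nat) : exists2 rho : R, 0 < rho &
  forall t, 0 <= t -> t <= rho ->
    [/\ 0 <= (inner_map d).[t], (inner_map d).[t] <= t,
        (inner_map d).[t] ^+ n <= t ^+ n * (1 - n%:R * - r / 4 * t ^+ q) &
        l1norm (theta * t) ((inner_map d \Po ('X + t%:P)) - ((inner_map d).[t])%:P)
          <= theta * (inner_map d).[t]].
Proof.
(* Relative to [theta t], the translate of the [d] term, estimated without any cancellation, costs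
   [(K - 1) |d tau^2|]; the last unit of [K] covers [d tau^2] in the value of the inner map. *)
pose K : R := (2 ^+ (2 * q).+1 + 1) / theta + 1.
have K0 : 0 < K by rewrite addr_gt0 // divr_gt0 // addr_gt0 // exprn_gt0.
(* The entries give [t <= 1], then [K |d| tau^2 <= - r tau / 2], then [- r tau p <= 1] for all [p]
   up to [(q + 2) (n + 1)], which dominates [2], [q + 1] and [n]. *)
pose s : R := Num.min 1 (Num.min (- r / (2 * K * (`|d| + 1)))
   ((- r * (q.+2 * n.+1)%:R)^-1)).
have nr0 : 0 < - r by rewrite oppr_gt0.
have d1 : 0 < `|d| + 1 by rewrite ltr_wpDl.
have s0 : 0 < s.
  rewrite /s !lt_min ltr01 /=; apply/andP; split.
    by apply: divr_gt0 => //; apply: mulr_gt0 => //; apply: mulr_gt0.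
  by rewrite invr_gt0; apply: mulr_gt0; rewrite ?ltr0n.
exists s => // t t0 ts.
have t1 : t <= 1 by rewrite (le_trans ts) // /s ge_min lexx.
set tau := t ^+ q.
have tau0 : 0 <= tau by rewrite exprn_ge0.
have taut : tau <= t.
  by rewrite /tau -(prednK q_gt0) exprS ler_piMr // exprn_ile1.
have tau1 : tau * K * (`|d| + 1) <= - r / 2.
  rewrite -mulrA -ler_pdivlMr ?mulr_gt0 // (le_trans taut) // (le_trans ts) //.
  have -> : - r / 2 / (K * (`|d| + 1)) = - r / (2 * K * (`|d| + 1)).
    by field; rewrite !gt_eqF.
  by rewrite /s !ge_min lexx orbT.
have rt : 0 <= - r * tau by rewrite mulr_ge0 // ltW.
have tau2 p : (p <= q.+2 * n.+1)%N -> - r * tau * p%:R <= 1.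
  move=> pqn; apply: (@le_trans _ _ (- r * tau * (q.+2 * n.+1)%:R)).
    by rewrite ler_wpM2l // ler_nat.
  rewrite mulrAC mulrC -ler_pdivlMr; last by rewrite mulr_gt0 // ltr0n.
  rewrite (le_trans taut) // (le_trans ts) //.
  by rewrite div1r /s !ge_min lexx !orbT.
have tau3 : - r * tau * q.+1%:R <= 1.
  by apply: tau2; rewrite (leq_trans (leqnSn _)) // leq_pmulr.
have tau5 : - r * tau * n%:R <= 1.
  by apply: tau2; rewrite (leq_trans (leqnSn _)) // leq_pmull.
have tau6 : - r * tau <= 1 / 2.
  by have := tau2 2%N (@leq_mul 2 1 q.+2 n.+1 isT isT); lra.
have dtau : `|d * tau ^+ 2| * K <= - r / 2 * tau.
  rewrite normrM normrX (ger0_norm tau0).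
  have : tau * K * `|d| <= - r / 2.
    by apply: le_trans tau1; rewrite ler_wpM2l ?lerDl // mulr_ge0 // ltW.
  move/(ler_wpM2r tau0); rewrite expr2; lra.
have K1 : 1 <= K by rewrite /K lerDr divr_ge0 ?ltW // addr_gt0 // exprn_gt0.
have dtau' : `|d * tau ^+ 2| <= - r / 2 * tau.
  by apply: le_trans dtau; rewrite ler_peMr.
have dtau2 := dtau'; rewrite ler_norml in dtau2; case/andP: dtau2 => dt1 dt2.
rewrite horner_inner_map -/tau; set g := 1 + r * tau + d * tau ^+ 2.
have g0 : 0 < g by rewrite /g; lra.
have g1 : g <= 1 - - r * tau / 2 by rewrite /g; lra.
split.
- by rewrite mulr_ge0 // ltW.
- by rewrite ler_piMr //; lra.
- rewrite exprMn ler_wpM2l ?exprn_ge0 //.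
  apply: (@le_trans _ _ ((1 - - r * tau / 2) ^+ n)).
    by apply: lerXn2r => //; rewrite nnegrE; lra.
  have -> : n%:R * - r / 4 * tau = n%:R * (- r * tau / 2) / 2 by field.
  apply: pow_one_sub_le; lra.
have e0 : 0 <= theta * t by rewrite mulr_ge0 // ltW.
set A := ('X + t%:P) ^+ q.+1 - (t ^+ q.+1)%:P - (q.+1%:R * t ^+ q)%:P * 'X.
have hA : l1norm (theta * t) A <= 4 ^+ q.+1 * theta ^+ 2 * t ^+ q.+1.
  by apply: l1norm_translate_remainder => //; exact: ltW.
set D := ('X + t%:P) ^+ (2 * q).+1 - (t ^+ (2 * q).+1)%:P.
have hD : l1norm (theta * t) D <= (2 ^+ (2 * q).+1 + 1) * t ^+ (2 * q).+1.
  apply: (le_trans (l1normB _ _ e0)); rewrite l1normC mulrDl mul1r.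
  rewrite ger0_norm ?exprn_ge0 // lerD2r -exprMn.
  apply: (le_trans (l1norm_exp _ _ e0)); apply: lerXn2r.
  - by rewrite nnegrE l1norm_ge0.
  - by rewrite nnegrE mulr_ge0.
  apply: (le_trans (l1normD _ _ e0)).
  rewrite l1normC -['X]expr1 l1normXn expr1 ger0_norm //.
  have := ler_wpM2r t0 theta_le1; lra.
have -> : (inner_map d \Po ('X + t%:P)) - (t * g)%:P =
    (1 + r * q.+1%:R * tau)%:P * 'X + r%:P * A + d%:P * D.
  rewrite /inner_map /inner_factor comp_polyM comp_polyX !comp_polyD !comp_polyM.
  rewrite !comp_polyC !comp_Xn_poly /A /D /g /tau -exprM (mulnC q).
  rewrite !exprS !polyCD !polyCM !polyCD !polyCM; ring.
apply: (le_trans (l1normD _ _ e0)).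
apply: (@le_trans _ _ ((1 + r * q.+1%:R * tau) * (theta * t) +
   - r * (4 ^+ q.+1 * theta ^+ 2 * t ^+ q.+1) +
   `|d| * ((2 ^+ (2 * q).+1 + 1) * t ^+ (2 * q).+1))).
  apply: lerD; last first.
    by apply: (le_trans (l1normM _ _ e0)); rewrite l1normC ler_wpM2l.
  apply: (le_trans (l1normD _ _ e0)); apply: lerD.
    apply: (le_trans (l1normM _ _ e0)).
    rewrite l1normC -['X]expr1 l1normXn expr1 ger0_norm //; lra.
  by apply: (le_trans (l1normM _ _ e0)); rewrite l1normC ltr0_norm // ler_wpM2l // ltW.
have th4 : 4 ^+ q.+1 * theta = 1 / 2.
  by rewrite /theta; field; rewrite expf_neq0.
have -> : - r * (4 ^+ q.+1 * theta ^+ 2 * t ^+ q.+1) = theta * t * (- r * tau / 2).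
  have -> : 4 ^+ q.+1 * theta ^+ 2 = 4 ^+ q.+1 * theta * theta by ring.
  by rewrite th4 exprS -/tau; field.
have -> : `|d| * ((2 ^+ (2 * q).+1 + 1) * t ^+ (2 * q).+1) =
   theta * t * (`|d * tau ^+ 2| * (K - 1)).
  rewrite /K addrK normrM normrX (ger0_norm tau0) /tau -exprM (mulnC q) !exprS.
  by field; rewrite gt_eqF.
have -> : (1 + r * q.+1%:R * tau) * (theta * t) + theta * t * (- r * tau / 2)
  + theta * t * (`|d * tau ^+ 2| * (K - 1)) = theta * t *
  (1 + r * q.+1%:R * tau - r * tau / 2 + `|d * tau ^+ 2| * (K - 1)) by ring.
rewrite [X in _ <= X]mulrA ler_wpM2l // /g.
have q1 : - r * tau <= - r * tau * q%:R by rewrite ler_peMr // ler1n.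
have := ler_norm (- (d * tau ^+ 2)); rewrite normrN -natr1; lra.
Qed.

End InnerMap.

(** * Truncated double series *)

Definition trunc_series (R : realType) (C : nat -> nat -> R) (p : nat)
    (A B : {poly R}) : {poly R} :=
  \sum_(i < p) \sum_(j < p) (C i j)%:P * (A ^+ i * B ^+ j).

Definition square_sum (R : realType) (C : nat -> nat -> R) (e : R) (p : nat) : R :=
  \sum_(i < p) \sum_(j < p) `|C i j| * e ^+ (i + j).

Lemma square_sumS (V : zmodType) (g : nat -> nat -> V) p :
  \sum_(i < p.+1) \sum_(j < p.+1) g i j - \sum_(i < p) \sum_(j < p) g i j =
  \sum_(i < p) g i p + \sum_(j < p.+1) g p j.
Proof.
rewrite big_ord_recr /=.
under eq_bigr do rewrite big_ord_recr /=.
rewrite big_split /= -addrA [X in X - _]addrC addrK addrC.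
by [].
Qed.

Lemma weight_predl kappa q w i j :
  (kappa * i.+1 + (kappa + q) * j = w + (kappa + 2 * q) ->
   w + 2 * q = kappa * i + (kappa + q) * j)%N.
Proof. by rewrite mulnS; lia. Qed.

Lemma weight_predr kappa q w i j :
  (kappa * i + (kappa + q) * j.+1 = w + (kappa + 2 * q) ->
   w + q = kappa * i + (kappa + q) * j)%N.
Proof. by rewrite mulnS; lia. Qed.

Section TruncatedSeries.
Context {R : realType}.
Variables (kappa q : nat) (C : nat -> nat -> R) (e S Q t0 theta : R).
Hypothesis kappa_gt0 : (0 < kappa)%N.
Hypothesis C_weight :
  forall i j, C i j != 0 -> (kappa + 2 * q <= weight kappa q i j)%N.
Hypotheses (e_gt0 : 0 < e) (theta_ge0 : 0 <= theta).
Hypothesis C_summable : forall p, square_sum C e p <= S.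
Hypotheses (Q_ge1 : 1 <= Q) (t0_gt0 : 0 < t0) (t0_le1 : t0 <= 1).
Hypothesis Qt0 : 2 * Q * t0 <= e.

Let W := (kappa + 2 * q)%N.

(** A monomial new at order [p + 1] has degree at least [p >= m], and [Q t <= e]. The factor
    [(Q t / e)^m] supplies smallness in [t]; the other factor remains a difference, so that its sum
    over [p] telescopes. *)
Lemma trunc_series_tail p m t (A B : {poly R}) : 0 <= t -> t <= t0 ->
  sector_norm theta t A <= Q * t ^+ kappa ->
  sector_norm theta t B <= Q * t ^+ (kappa + q) -> (m <= p)%N ->
  sector_norm theta t (trunc_series C p.+1 A B - trunc_series C p A B) <=
    (Q * t / e) ^+ m * (square_sum C e p.+1 - square_sum C e p).
Proof.
move=> t_ge0 tt0 hA hB mp; have Q0 : 0 <= Q by apply: le_trans Q_ge1.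
have t1 : t <= 1 by exact: le_trans t0_le1.
have pow_le k : (0 < k)%N -> t ^+ k <= t.
  by move=> k0; rewrite -(prednK k0) exprS ler_piMr // exprn_ile1.
have {}hA : sector_norm theta t A <= Q * t.
  by rewrite (le_trans hA) // ler_wpM2l // pow_le.
have {}hB : sector_norm theta t B <= Q * t.
  by rewrite (le_trans hB) // ler_wpM2l // pow_le // addn_gt0 kappa_gt0.
have Qte : Q * t <= e.
  apply: le_trans Qt0; rewrite -mulrA; have := ler_wpM2l Q0 tt0.
  have : 0 <= Q * t0 by rewrite mulr_ge0 // ltW.
  lra.
have term i j : (m <= i + j)%N ->
    sector_norm theta t ((C i j)%:P * (A ^+ i * B ^+ j)) <=
    (Q * t / e) ^+ m * (`|C i j| * e ^+ (i + j)).
  move=> mij; rewrite (le_trans (sector_normM _ _ _ _)) // sector_normC.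
  rewrite mulrCA ler_wpM2l //.
  apply: (@le_trans _ _ ((Q * t) ^+ (i + j))).
    rewrite (le_trans (sector_normM _ _ _ _)) // exprD.
    by apply: ler_pM; rewrite ?sector_norm_ge0 //;
      apply: (le_trans (sector_norm_exp _ _ _ _)) => //;
      apply: lerXn2r; rewrite ?nnegrE ?sector_norm_ge0 ?mulr_ge0.
  rewrite -(subnKC mij) !exprD expr_div_n mulrA divfK ?expf_neq0 ?gt_eqF //.
  rewrite ler_wpM2l ?exprn_ge0 ?mulr_ge0 //.
  by apply: lerXn2r; rewrite ?nnegrE ?mulr_ge0 // ltW.
rewrite /trunc_series /square_sum.
rewrite (square_sumS (fun i j => (C i j)%:P * (A ^+ i * B ^+ j))).
rewrite (square_sumS (fun i j => `|C i j| * e ^+ (i + j))).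
rewrite (le_trans (sector_normD _ _ _ _)) // mulrDr !mulr_sumr.
apply: lerD; apply: (le_trans (sector_norm_sum _ _ _ _)) => //;
  apply: ler_sum => i _; apply: term.
- by rewrite (leq_trans mp) // leq_addl.
- by rewrite (leq_trans mp) // leq_addr.
Qed.

(** A monomial of degree [s] offers only [t^w] once [W] powers of [t] are set aside. As
    [s <= w + W], these are borrowed from the fixed [t0], at the price [t0^-W] in the Lipschitz
    constant. The factor [2^s] absorbs the degree produced by differentiation. *)
Let weighted_pow_le t s w : 0 <= t -> t <= t0 -> (s <= w + W)%N ->
  (2 * Q) ^+ s * t ^+ w <= e ^+ s / t0 ^+ W.
Proof.
move=> t_ge0 tt0 sw; have Q0 : 0 <= Q by apply: le_trans Q_ge1.
rewrite ler_pdivlMr ?exprn_gt0 // -mulrA.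
apply: (@le_trans _ _ ((2 * Q) ^+ s * t0 ^+ s)); last first.
  rewrite -exprMn; apply: lerXn2r => //; rewrite nnegrE; last exact: ltW.
  by rewrite !mulr_ge0 // ltW.
rewrite ler_wpM2l ?exprn_ge0 ?mulr_ge0 //.
apply: (@le_trans _ _ (t0 ^+ w * t0 ^+ W)).
  rewrite ler_wpM2r ?exprn_ge0 ?(ltW t0_gt0) //.
  by apply: lerXn2r; rewrite ?nnegrE // ltW.
rewrite -exprD -(subnKC sw) exprD ler_piMr ?exprn_ge0 ?(ltW t0_gt0) //.
by rewrite exprn_ile1 // ltW.
Qed.

(** Monomials are compared one by one, changing [A] and [B] in turn. If [w] is the excess of weight
    over [kappa + 2 q], giving up one factor [x] leaves weight [w + 2 q] and giving up one factor
    [y] leaves [w + q]: hence the two powers of [t]. The constant is independent of [p]. *)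
Lemma trunc_series_lipschitz p t (A B A' B' : {poly R}) :
  0 <= t -> t <= t0 ->
  sector_norm theta t A <= Q * t ^+ kappa ->
  sector_norm theta t A' <= Q * t ^+ kappa ->
  sector_norm theta t B <= Q * t ^+ (kappa + q) ->
  sector_norm theta t B' <= Q * t ^+ (kappa + q) ->
  sector_norm theta t (trunc_series C p A B - trunc_series C p A' B') <=
    S / t0 ^+ W * (t ^+ (2 * q) * sector_norm theta t (A - A') +
                   t ^+ q * sector_norm theta t (B - B')).
Proof.
move=> t_ge0 tt0 hA hA' hB hB'; have Q0 : 0 <= Q by apply: le_trans Q_ge1.
set nu := sector_norm theta t; set x := Q * t ^+ kappa in hA hA'.
set y := Q * t ^+ (kappa + q) in hB hB'.
have x0 : 0 <= x by rewrite mulr_ge0 ?exprn_ge0.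
have y0 : 0 <= y by rewrite mulr_ge0 ?exprn_ge0.
have nu_ge0 P : 0 <= nu P by exact: sector_norm_ge0.
have nu_pow (P : {poly R}) z k : nu P <= z -> nu (P ^+ k) <= z ^+ k.
  move=> Pz; apply: (le_trans (sector_norm_exp _ _ _ _)) => //.
  by apply: lerXn2r; rewrite ?nnegrE // (le_trans _ Pz).
set d := t ^+ (2 * q) * nu (A - A') + t ^+ q * nu (B - B').
have d0 : 0 <= d by rewrite addr_ge0 // mulr_ge0 ?exprn_ge0.
have Qpow k s : (k <= s)%N -> forall z, (z <= s)%N ->
    z%:R * Q ^+ k <= (2 * Q) ^+ s.
  move=> ks z zs; rewrite exprMn; apply: ler_pM; rewrite ?exprn_ge0 //.
    by rewrite -natrX ler_nat (leq_trans zs) // ltnW // ltn_expl.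
  exact: ler_weXn2l.
have term i j : nu ((C i j)%:P * (A ^+ i * B ^+ j) - (C i j)%:P * (A' ^+ i * B' ^+ j))
    <= `|C i j| * e ^+ (i + j) / t0 ^+ W * d.
  have [->|Cij] := eqVneq (C i j) 0.
    by rewrite normr0 !mul0r subrr -[0]/(0%:P) /nu sector_normC normr0.
  rewrite -mulrBr (le_trans (sector_normM _ _ _ _)) // sector_normC -!mulrA.
  rewrite ler_wpM2l // [X in _ <= X]mulrA.
  have -> : A ^+ i * B ^+ j - A' ^+ i * B' ^+ j =
    (A ^+ i - A' ^+ i) * B ^+ j + A' ^+ i * (B ^+ j - B' ^+ j) by ring.
  apply: (@le_trans _ _ (i%:R * x ^+ i.-1 * nu (A - A') * y ^+ j +
      x ^+ i * (j%:R * y ^+ j.-1 * nu (B - B')))).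
    apply: (le_trans (sector_normD _ _ _ _)) => //.
    by apply: lerD; apply: (le_trans (sector_normM _ _ _ _)) => //; apply: ler_pM;
      rewrite ?sector_norm_ge0 // ?nu_pow //; apply: sector_norm_subX.
  have w_ge := C_weight Cij; rewrite /weight -/W in w_ge.
  pose w := (kappa * i + (kappa + q) * j - W)%N.
  have sw : (i + j <= w + W)%N.
    rewrite subnK //; apply: leq_add; first by rewrite leq_pmull.
    by rewrite leq_pmull // addn_gt0 kappa_gt0.
  have wE : (kappa * i + (kappa + q) * j = w + W)%N by rewrite subnK.
  have bound := weighted_pow_le t_ge0 tt0 sw.
  rewrite /d mulrDr; apply: lerD.
    have -> : i%:R * x ^+ i.-1 * nu (A - A') * y ^+ j =
      i%:R * (x ^+ i.-1 * y ^+ j) * nu (A - A') by ring.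
    rewrite [X in _ <= X]mulrA ler_wpM2r //.
    case: i Cij w_ge w sw wE bound => [|i] Cij w_ge w sw wE bound /=.
      by rewrite mul0r mulr_ge0 ?exprn_ge0 // mulr_ge0 ?invr_ge0 ?exprn_ge0 // ltW.
    have -> : x ^+ i * y ^+ j = Q ^+ (i + j) * (t ^+ w * t ^+ (2 * q)).
      rewrite /x /y !exprMn -!exprM -exprD exprD.
      have -> : (w + 2 * q = kappa * i + (kappa + q) * j)%N.
        exact: weight_predl wE.
      rewrite exprD; ring.
    rewrite !mulrA ler_wpM2r ?exprn_ge0 //; apply: le_trans bound.
    by rewrite ler_wpM2r ?exprn_ge0 // Qpow ?leq_addr // addSn leqnSn.
  have -> : x ^+ i * (j%:R * y ^+ j.-1 * nu (B - B')) =
    j%:R * (x ^+ i * y ^+ j.-1) * nu (B - B') by ring.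
  rewrite [X in _ <= X]mulrA ler_wpM2r //.
  case: j Cij w_ge w sw wE bound => [|j] Cij w_ge w sw wE bound /=.
    by rewrite mul0r mulr_ge0 ?exprn_ge0 // mulr_ge0 ?invr_ge0 ?exprn_ge0 // ltW.
  have -> : x ^+ i * y ^+ j = Q ^+ (i + j) * (t ^+ w * t ^+ q).
    rewrite /x /y !exprMn -!exprM -exprD.
    have -> : (w + q = kappa * i + (kappa + q) * j)%N.
      exact: weight_predr wE.
    rewrite !exprD; ring.
  rewrite !mulrA ler_wpM2r ?exprn_ge0 //; apply: le_trans bound.
  by rewrite ler_wpM2r ?exprn_ge0 // Qpow ?leq_addl // addnS leqnSn.
rewrite /trunc_series -sumrB.
under eq_bigr do rewrite -sumrB.
apply: (@le_trans _ _ (square_sum C e p / t0 ^+ W * d)); last first.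
  by rewrite ler_wpM2r // ler_wpM2r // invr_ge0 exprn_ge0 // ltW.
rewrite /square_sum !mulr_suml; apply: (le_trans (sector_norm_sum _ _ _ _)) => //.
apply: ler_sum => i _; rewrite !mulr_suml.
apply: (le_trans (sector_norm_sum _ _ _ _)) => //.
by apply: ler_sum => j _; exact: term.
Qed.

End TruncatedSeries.

(** * Convergence of the iteration *)

Section Iteration.
Context {R : realType}.
Variables (kappa q n m0 : nat) (C : nat -> nat -> R).
Variables (e S Q t0 theta c nu rho : R) (F X0 Y0 : {poly R}).

(** The truncation order must tend to infinity to recover [f] in the limit; starting it at a large
    [m0] makes even the first truncation errors small in [t]. *)
Fixpoint backward_iter m : {poly R} * {poly R} :=
  if m is m'.+1 then
    let: (X, Y) := backward_iter m' in
    (X \Po F - c%:P * Y, Y \Po F - trunc_series C (m0 + m') X Y)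
  else (X0, Y0).

Let X m := (backward_iter m).1.
Let Y m := (backward_iter m).2.
Let N := sector_norm theta.
Let L := S / t0 ^+ (kappa + 2 * q).

Lemma backward_iterSX m : X m.+1 = X m \Po F - c%:P * Y m.
Proof. by rewrite /X /Y /=; case: (backward_iter m). Qed.

Lemma backward_iterSY m : Y m.+1 = Y m \Po F - trunc_series C (m0 + m) (X m) (Y m).
Proof. by rewrite /X /Y /=; case: (backward_iter m). Qed.

Hypothesis kappa_gt0 : (0 < kappa)%N.
Hypothesis C_weight :
  forall i j, C i j != 0 -> (kappa + 2 * q <= weight kappa q i j)%N.
Hypotheses (e_gt0 : 0 < e) (theta_ge0 : 0 <= theta) (c_ge0 : 0 <= c).
Hypothesis C_summable : forall p, square_sum C e p <= S.
Hypotheses (Q_ge1 : 1 <= Q) (t0_gt0 : 0 < t0) (t0_le1 : t0 <= 1).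
Hypothesis Qt0 : 2 * Q * t0 <= e.
Hypothesis rho_t0 : rho <= t0.
Hypothesis nu_ge : 2 + c + 2 * L <= nu.

Hypothesis F_bounds : forall t, 0 <= t -> t <= rho ->
  [/\ 0 <= F.[t], F.[t] <= t, F.[t] ^+ n <= t ^+ n * (1 - nu * t ^+ q) &
      l1norm (theta * t) ((F \Po ('X + t%:P)) - (F.[t])%:P) <= theta * F.[t]].
Hypothesis base_bounds : forall t, 0 <= t -> t <= rho ->
  N t (X 1 - X 0) <= t ^+ (n + q) /\ N t (Y 1 - Y 0) <= t ^+ (n + 2 * q).
Hypothesis init_bounds : forall t, 0 <= t -> t <= rho ->
  N t (X 0) + t ^+ n <= Q * t ^+ kappa /\
  N t (Y 0) + t ^+ (n + q) <= Q * t ^+ (kappa + q).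
Hypothesis tail_bound : forall t, 0 <= t -> t <= rho ->
  (Q * t / e) ^+ m0 * S <= t ^+ (n + 2 * q).

Let S_ge0 : 0 <= S.
Proof.
by apply: le_trans (C_summable 0); rewrite /square_sum big_ord0.
Qed.

Let L_ge0 : 0 <= L.
Proof. by rewrite divr_ge0 // exprn_ge0 // ltW. Qed.

Let increments_bounded j t := \sum_(m < j) N t (X m.+1 - X m) <= t ^+ n /\
  \sum_(m < j) N t (Y m.+1 - Y m) <= t ^+ (n + q).

Let backward_iter_bounded j t : 0 <= t -> t <= rho -> increments_bounded j t ->
  forall m, (m <= j)%N ->
    N t (X m) <= Q * t ^+ kappa /\ N t (Y m) <= Q * t ^+ (kappa + q).
Proof.
move=> t_ge0 trho [hX hY] m mj.
have aux (Z : nat -> {poly R}) :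
    N t (Z m) <= N t (Z 0) + \sum_(k < j) N t (Z k.+1 - Z k).
  apply: (@le_trans _ _ (N t (Z 0) + \sum_(k < m) N t (Z k.+1 - Z k))).
    elim: m {mj} => [|m IH]; first by rewrite big_ord0 addr0.
    have -> : Z m.+1 = Z m + (Z m.+1 - Z m) by ring.
    rewrite (le_trans (sector_normD _ _ _ _)) // big_ord_recr /= addrA lerD //.
  rewrite lerD2l (big_ord_widen _ (fun k => N t (Z k.+1 - Z k)) mj) big_mkcond /=.
  by apply: ler_sum => i _; case: ifP => // _; exact: sector_norm_ge0.
have [iX iY] := init_bounds t_ge0 trho.
split; [apply: le_trans iX|apply: le_trans iY];
  apply: (le_trans (aux _)); exact: lerD.
Qed.

(** The sum at [t] over [j + 1] steps is the first increment plus sums over [j] steps at [F(t)] and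
    at [t], so the induction on [j] must quantify over [t]. Relative to [t^q], the losses are
    [1 + c] for [X] (first increment, term [c Y]) and [2 + 2 L] for [Y] (first increment,
    truncation, Lipschitz terms); [nu] exceeds both. *)
Lemma backward_iter_increments j t : 0 <= t -> t <= rho ->
  \sum_(m < j) N t (X m.+1 - X m) <= t ^+ n /\
  \sum_(m < j) N t (Y m.+1 - Y m) <= t ^+ (n + q).
Proof.
rewrite -/(increments_bounded j t).
elim: j t => [|j IH] t t_ge0 trho.
  by rewrite /increments_bounded !big_ord0 !exprn_ge0.
have [F_ge0 F_le Fn F_contract] := F_bounds t_ge0 trho.
have [bX bY] := base_bounds t_ge0 trho.
have tt0 : t <= t0 by exact: le_trans rho_t0.
have IHt := IH t t_ge0 trho; have [sX sY] := IHt.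
have [sFX sFY] := IH F.[t] F_ge0 (le_trans F_le trho).
have bnd := backward_iter_bounded t_ge0 trho IHt.
have compN (P P' : {poly R}) : N t ((P \Po F) - (P' \Po F)) <= N F.[t] (P - P').
  by rewrite -comp_polyB; apply: sector_norm_comp.
set tau := t ^+ q in Fn *.
have tn0 : 0 <= t ^+ n by rewrite exprn_ge0.
have tau0 : 0 <= tau by rewrite exprn_ge0.
have tnq : t ^+ (n + q) = t ^+ n * tau by rewrite exprD.
have tn2q : t ^+ (n + 2 * q) = t ^+ n * tau * tau by rewrite mul2n -addnn addnA !exprD.
have key : t ^+ n * tau * (2 + c + 2 * L) <= t ^+ n * tau * nu.
  by rewrite ler_wpM2l // mulr_ge0.
have tt : 0 <= t ^+ n * tau by rewrite mulr_ge0.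
have Lt : 0 <= t ^+ n * tau * L by rewrite mulr_ge0.
have ct : 0 <= t ^+ n * tau * c by rewrite mulr_ge0.
split; rewrite big_ord_recl.
  apply: (@le_trans _ _ (t ^+ (n + q) + (F.[t] ^+ n + c * t ^+ (n + q)))).
    apply: lerD => //; apply: (@le_trans _ _ (\sum_(m < j) N F.[t] (X m.+1 - X m) +
        c * \sum_(m < j) N t (Y m.+1 - Y m))); last by rewrite lerD // ler_wpM2l.
    rewrite mulr_sumr -big_split /=; apply: ler_sum => m _.
    rewrite /bump /= add1n (backward_iterSX m.+1) {2}(backward_iterSX m).
    have -> : X m.+1 \Po F - c%:P * Y m.+1 - (X m \Po F - c%:P * Y m) =
      ((X m.+1 \Po F) - (X m \Po F)) - c%:P * (Y m.+1 - Y m) by ring.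
    apply: (le_trans (sector_normB _ _ _ _)) => //; apply: lerD => //.
    apply: (le_trans (sector_normM _ _ _ _)) => //.
    by rewrite sector_normC ger0_norm.
  by rewrite tnq; lra.
apply: (@le_trans _ _ (t ^+ (n + 2 * q) + (F.[t] ^+ (n + q) +
    (L * (t ^+ (2 * q) * t ^+ n + tau * t ^+ (n + q)) + t ^+ (n + 2 * q))))).
  apply: lerD => //.
  apply: (@le_trans _ _ (\sum_(m < j) N F.[t] (Y m.+1 - Y m) +
      (L * (t ^+ (2 * q) * \sum_(m < j) N t (X m.+1 - X m) +
            tau * \sum_(m < j) N t (Y m.+1 - Y m)) +
       \sum_(m < j) (Q * t / e) ^+ m0 *
         (square_sum C e (m0 + m).+1 - square_sum C e (m0 + m))))); last first.
    apply: lerD => //; apply: lerD.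
      by rewrite ler_wpM2l // lerD // ler_wpM2l // exprn_ge0.
    apply: le_trans (tail_bound t_ge0 trho); rewrite -mulr_sumr ler_wpM2l //.
      by rewrite exprn_ge0 // divr_ge0 ?(ltW e_gt0) // mulr_ge0 // (le_trans _ Q_ge1).
    under eq_bigr do rewrite -addnS.
    rewrite -(big_mkord xpredT (fun m =>
      square_sum C e (m0 + m.+1) - square_sum C e (m0 + m))) /=.
    rewrite (@telescope_sumr _ 0 j (fun m => square_sum C e (m0 + m))) //.
    rewrite (le_trans _ (C_summable (m0 + j))) // lerBlDr lerDl.
    by apply: sumr_ge0 => i _; apply: sumr_ge0 => k _;
      rewrite mulr_ge0 // exprn_ge0 // ltW.
  rewrite !mulr_sumr -big_split /= mulr_sumr -!big_split /=.
  apply: ler_sum => m _.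
  rewrite /bump /= add1n (backward_iterSY m.+1) {3}(backward_iterSY m).
  (* Three contributions: composition with [F], a Lipschitz difference at a common truncation order,
     and the raising of that order by one at a fixed argument. *)
  have -> : Y m.+1 \Po F - trunc_series C (m0 + m.+1) (X m.+1) (Y m.+1) -
      (Y m \Po F - trunc_series C (m0 + m) (X m) (Y m)) =
    ((Y m.+1 \Po F) - (Y m \Po F)) -
    ((trunc_series C (m0 + m).+1 (X m.+1) (Y m.+1) -
      trunc_series C (m0 + m).+1 (X m) (Y m)) +
     (trunc_series C (m0 + m).+1 (X m) (Y m) -
      trunc_series C (m0 + m) (X m) (Y m))) by rewrite addnS; ring.
  apply: (le_trans (sector_normB _ _ _ _)) => //; apply: lerD => //.
  apply: (le_trans (sector_normD _ _ _ _)) => //.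
  have [m1X m1Y] := bnd m.+1 (ltn_ord m).
  have [mX mY] := bnd m (ltnW (ltn_ord m)).
  apply: lerD; first exact: (trunc_series_lipschitz kappa_gt0 C_weight e_gt0
    theta_ge0 C_summable Q_ge1 t0_gt0 t0_le1 Qt0).
  exact: (trunc_series_tail C kappa_gt0 e_gt0 theta_ge0 Q_ge1 t0_gt0 t0_le1
    Qt0 t_ge0 tt0 mX mY (leq_addr _ _)).
have Fnq : F.[t] ^+ (n + q) <= t ^+ n * (1 - nu * tau) * tau.
  rewrite exprD; apply: ler_pM; rewrite ?exprn_ge0 //.
  by apply: lerXn2r; rewrite ?nnegrE.
have key2 := ler_wpM2r tau0 key.
have ctt := mulr_ge0 ct tau0.
have t2q : t ^+ (2 * q) = tau * tau by rewrite mul2n -addnn exprD.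
rewrite tnq tn2q t2q; lra.
Qed.

Lemma backward_iter_norm_le m t : 0 <= t -> t <= rho ->
  N t (X m) <= Q * t ^+ kappa /\ N t (Y m) <= Q * t ^+ (kappa + q).
Proof.
move=> t_ge0 trho; apply: backward_iter_bounded (leqnn m) => //.
exact: backward_iter_increments.
Qed.

End Iteration.

(** * Choice of the constants *)

Lemma sector_norm_mulXn (R : realType) (theta t : R) (a : nat) (P : {poly R}) :
  0 <= theta -> theta <= 1 -> 0 <= t ->
  sector_norm theta t ('X^a * P) <= 2 ^+ a * t ^+ a * l1norm (2 * t) P.
Proof.
move=> th0 th1 t0; apply: (le_trans (sector_norm_le_l1norm _ _ _)) => //.
have t2 : (1 + theta) * t <= 2 * t by rewrite ler_wpM2r //; lra.
apply: (@le_trans _ _ (l1norm (2 * t) ('X^a * P))).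
  by apply: l1norm_le => //; rewrite mulr_ge0 // addr_ge0.
rewrite (le_trans (l1normM _ _ _)) ?mulr_ge0 // l1normXn exprMn.
by [].
Qed.

Lemma l1norm_le_coef0 (R : realType) (t : R) (P : {poly R}) :
  0 <= t -> 2 * t <= 1 ->
  l1norm (2 * t) P <= `|P`_0| + 2 * l1norm 1 P * t.
Proof.
move=> t0 t1; rewrite /l1norm; case: (size P) => [|k].
  by rewrite !big_ord0 mulr0 mul0r addr0.
rewrite !big_ord_recl /= !expr0 !mulr1 lerD2l mulrDr mulrDl ler_wpDl //.
  by rewrite !mulr_ge0.
rewrite mulr_sumr mulr_suml; apply: ler_sum => i _.
rewrite expr1n mulr1 mulrAC (mulrC _ `|_|) ler_wpM2l // exprS.
by rewrite ler_piMr ?mulr_ge0 // exprn_ile1 // mulr_ge0.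
Qed.

Section ApproximationExists.
Context {R : realType}.
Variables (kappa q m1 : nat) (c r y0 e S delta : R) (C : nat -> nat -> R).
Hypotheses (q_gt0 : (0 < q)%N) (kappa_gt0 : (0 < kappa)%N).
Hypothesis C_weight :
  forall i j, C i j != 0 -> (kappa + 2 * q <= weight kappa q i j)%N.
Hypotheses (e_gt0 : 0 < e) (delta_gt0 : 0 < delta) (r_lt0 : r < 0) (c_gt0 : 0 < c).
Hypothesis C_summable : forall p, square_sum C e p <= S.
Hypothesis cy0 : c * y0 = kappa%:R * r.
Hypothesis lead_balance : forall m, (m1 <= m)%N ->
  lead_sum kappa q C m (fun i j => y0 ^+ j) = (kappa + q)%:R * y0 * r.
Hypothesis lead_slope : forall m, (m1 <= m)%N ->
  r * q.+1%:R <= lead_sum kappa q C m (fun i j => j%:R * y0 ^+ j.-1).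

(** [theta], [Q], [t0] and [L] depend on the data only; then [n] is chosen against [L], [m0] against
    [n], next comes the formal solution, and last [rho], which depends on its coefficients. There is
    no circularity because [Q], and with it [L], involves only the leading coefficients [1] and
    [y0]. *)
Lemma parabolic_approximations :
  exists (theta rho d Q L : R) (n m0 : nat) (X0 Y0 : {poly R}) (X Y : nat -> {poly R}),
  let F := inner_map q r d in
  [/\ [/\ 0 < theta, 0 < rho <= 1, 1 <= Q, Q * rho < e & Q * rho < delta],
      [/\ X 0 = 'X^kappa * X0, Y 0 = 'X^(kappa + q) * Y0, X0`_0 = 1, Y0`_0 = y0
        & (kappa < n)%N],
      forall m, X m.+1 = X m \Po F - c%:P * Y m /\
        Y m.+1 = Y m \Po F - trunc_series C (m0 + m) (X m) (Y m),
      forall t, 0 <= t -> t <= rho ->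
        0 <= F.[t] /\ F.[t] <= t &
      forall t, 0 <= t -> t <= rho ->
      [/\ forall j, \sum_(m < j) sector_norm theta t (X m.+1 - X m) <= t ^+ n,
          forall j, \sum_(m < j) sector_norm theta t (Y m.+1 - Y m) <= t ^+ (n + q),
          forall m, sector_norm theta t (X m) <= Q * t ^+ kappa /\
            sector_norm theta t (Y m) <= Q * t ^+ (kappa + q) &
          forall p A B A' B', `|A| <= Q * t ^+ kappa -> `|A'| <= Q * t ^+ kappa ->
            `|B| <= Q * t ^+ (kappa + q) -> `|B'| <= Q * t ^+ (kappa + q) ->
            `|\sum_(i < p) \sum_(j < p) C i j * A ^+ i * B ^+ j -
              \sum_(i < p) \sum_(j < p) C i j * A' ^+ i * B' ^+ j| <=
              L * (`|A - A'| + `|B - B'|)]].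
Proof.
pose theta : R := (2 * 4 ^+ q.+1)^-1.
have theta_gt0 : 0 < theta by rewrite invr_gt0 mulr_gt0 ?exprn_gt0.
have theta_ge0 := ltW theta_gt0.
have theta_le1 : theta <= 1.
  rewrite invf_le1 ?mulr_gt0 ?exprn_gt0 // -natrX -natrM ler1n.
  by rewrite muln_gt0 expn_gt0.
pose M := (kappa + q)%N; pose W := (kappa + 2 * q)%N.
(* [|y0| + 2] exceeds [1] and [|y0|] by at least one, which leaves room for the higher coefficients
   at small [t]; [2^M] comes from evaluation at [2 t], and the final [1] covers the sum of the
   increments. *)
pose Q : R := 2 ^+ M * (`|y0| + 2) + 1.
have p2 k : (0 : R) < 2 ^+ k by rewrite exprn_gt0.
have yn0 : 0 <= `|y0| by [].
have Q1 : 1 <= Q by rewrite /Q lerDr mulr_ge0 ?addr_ge0 // ltW.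
have Q0 : 0 < Q by apply: lt_le_trans Q1.
pose t0 : R := Num.min 1 (e / (2 * Q)).
have t0_gt0 : 0 < t0 by rewrite /t0 lt_min ltr01 divr_gt0 // mulr_gt0.
have t0_le1 : t0 <= 1 by rewrite /t0 ge_min lexx.
have Qt0 : 2 * Q * t0 <= e.
  rewrite mulrC -ler_pdivlMr ?mulr_gt0 // /t0 ge_min lexx orbT //.
pose L := S / t0 ^+ W.
have S_ge0 : 0 <= S by apply: le_trans (C_summable 0); rewrite /square_sum big_ord0.
have L_ge0 : 0 <= L by rewrite divr_ge0 // exprn_ge0 // ltW.
have nr0 : 0 < - r by rewrite oppr_gt0.
have [n kn nu_ge] : exists2 n, (kappa < n)%N & 2 + c + 2 * L <= n%:R * - r / 4.
  pose b := (2 + c + 2 * L) * 4 / - r.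
  have b0 : 0 <= b.
    apply: divr_ge0 (ltW nr0); apply: mulr_ge0 => //.
    exact: addr_ge0 (addr_ge0 _ (ltW c_gt0)) (mulr_ge0 _ L_ge0).
  have bN := archi_boundP b0; exists (Num.bound b + kappa.+1)%N.
    by rewrite addnS ltnS leq_addl.
  rewrite ler_pdivlMr // -ler_pdivrMr // -/b natrD.
  by rewrite (le_trans (ltW bN)) // lerDl.
(* [m0 >= m1] makes the leading sums complete; [m0 > n + 2 q] makes the truncation errors
   [O(t^(n + 2 q + 1))]. *)
pose m0 := maxn m1 (n + 2 * q).+1.
have m1m0 : (m1 <= m0)%N by rewrite leq_maxl.
have nm0 : (n + 2 * q < m0)%N by rewrite leq_maxr.
(* With this order the first increments are divisible by [X^(n + q + 1)] and [X^(n + 2 q + 1)]: one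
   power more than the bounds ask for, so that a small [t] absorbs the constants. *)
have n'0 : (0 < (n - kappa).+1)%N by [].
have [X0 [Y0 [d [X00 Y00 EX EY]]]] := formal_solution q_gt0 kappa_gt0 C_weight
  r_lt0 c_gt0 cy0 (lead_balance m1m0) (lead_slope m1m0) n'0.
case: EX => SX EX; case: EY => SY EY; rewrite add0r in EX; rewrite add0r in EY.
set F := inner_map q r d; set G := inner_factor q r d in EX EY.
have [rho1 rho1_gt0 Fb] := inner_map_bounds q_gt0 r_lt0 d n.
pose a1 : R := 2 ^+ (n + q).+1 * l1norm 2 SX.
pose a2 : R := 2 ^+ (n + 2 * q).+1 * l1norm 2 SY.
pose a3 : R := 2 * l1norm 1 X0.
pose a4 : R := 2 * l1norm 1 Y0.
pose a5 : R := (Q / e) ^+ m0 * S.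
pose a6 : R := 2 * Q / e.
pose a7 : R := 2 * Q / delta.
have a1_ge0 : 0 <= a1 by rewrite mulr_ge0 ?l1norm_ge0 ?(ltW (p2 _)).
have a2_ge0 : 0 <= a2 by rewrite mulr_ge0 ?l1norm_ge0 ?(ltW (p2 _)).
have a3_ge0 : 0 <= a3 by rewrite mulr_ge0 ?l1norm_ge0.
have a4_ge0 : 0 <= a4 by rewrite mulr_ge0 ?l1norm_ge0.
have a5_ge0 : 0 <= a5 by rewrite mulr_ge0 // exprn_ge0 // divr_ge0 // ltW.
have a6_ge0 : 0 <= a6 by rewrite divr_ge0 ?mulr_ge0 ?(ltW e_gt0) ?(ltW Q0).
have a7_ge0 : 0 <= a7 by rewrite divr_ge0 ?mulr_ge0 ?(ltW delta_gt0) ?(ltW Q0).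
(* One number above all constants met: [t <= a^-1] makes each of them, times [t], at most [1]. *)
pose a := 2 + a1 + a2 + a3 + a4 + a5 + a6 + a7.
have a_gt0 : 0 < a by rewrite /a !ltr_wpDr.
pose rho := Num.min t0 (Num.min rho1 a^-1).
have rho_gt0 : 0 < rho by rewrite lt_min t0_gt0 /= lt_min rho1_gt0 invr_gt0.
have rho_t0 : rho <= t0 by rewrite ge_min lexx.
have rho_rho1 : rho <= rho1 by rewrite ge_min [X in _ || X]ge_min lexx orbT.
have rho_a : rho <= a^-1 by rewrite ge_min [X in _ || X]ge_min lexx !orbT.
have small b t : 0 <= t -> t <= rho -> b <= a -> b * t <= 1.
  move=> t_ge0 trho ba; have ta : t <= a^-1 by exact: le_trans rho_a.
  apply: (@le_trans _ _ (a * t)); first by rewrite ler_wpM2r.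
  by rewrite mulrC -ler_pdivlMr // div1r.
have F_bounds t : 0 <= t -> t <= rho ->
  [/\ 0 <= F.[t], F.[t] <= t, F.[t] ^+ n <= t ^+ n * (1 - n%:R * - r / 4 * t ^+ q) &
      l1norm (theta * t) ((F \Po ('X + t%:P)) - (F.[t])%:P) <= theta * F.[t]].
  by move=> t_ge0 trho; exact: Fb t t_ge0 (le_trans trho rho_rho1).
pose XY := backward_iter m0 C c F ('X^kappa * X0) ('X^M * Y0).
pose X m := (XY m).1; pose Y m := (XY m).2.
have FE : F = 'X * G by [].
have X1E : X 1%N - X 0%N = - ('X^((n + q).+1) * SX).
  have -> : X 1%N = ('X^kappa * X0) \Po F - c%:P * ('X^M * Y0) by [].
  have -> : X 0%N = 'X^kappa * X0 by [].
  rewrite comp_polyM comp_Xn_poly FE.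
  have -> : ((n + q).+1 = kappa + ((n - kappa).+1 + q))%N.
    by rewrite addSn addnS addnA subnKC // ltnW.
  rewrite (exprD _ kappa (_ + q)) -mulrA -EX /errX -/G exprMn /M exprD; ring.
have Y1E : Y 1%N - Y 0%N = - ('X^((n + 2 * q).+1) * SY).
  have -> : Y 1%N = ('X^M * Y0) \Po F -
    trunc_series C (m0 + 0) ('X^kappa * X0) ('X^M * Y0) by [].
  have -> : Y 0%N = 'X^M * Y0 by [].
  have -> : trunc_series C (m0 + 0) ('X^kappa * X0) ('X^M * Y0) =
      'X^M * ('X^q * scaled_map kappa q C m0 X0 Y0).
    rewrite addn0 mulrA -exprD /scaled_map /trunc_series mulr_sumr.
    apply: eq_bigr => i _; rewrite mulr_sumr; apply: eq_bigr => j _.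
    have [->|Cij] := eqVneq (C i j) 0; first by rewrite !mul0r mulr0.
    rewrite !exprMn -!exprM.
    have -> : 'X^(kappa * i) * X0 ^+ i * ('X^(M * j) * Y0 ^+ j) =
      'X^(weight kappa q i j) * (X0 ^+ i * Y0 ^+ j) by rewrite /weight exprD; ring.
    have Wq : (M + q = kappa + 2 * q)%N by rewrite /M -addnA addnn mul2n.
    rewrite Wq -{1}(subnKC (C_weight Cij)) exprD; ring.
  rewrite comp_polyM comp_Xn_poly FE.
  have -> : ((n + 2 * q).+1 = M + ((n - kappa).+1 + q))%N.
    rewrite /M mul2n -addnn addSn addnS; congr _.+1.
    by rewrite addnACA subnKC 1?ltnW // addnA.
  rewrite (exprD _ M (_ + q)) -mulrA -EY /errY -/G exprMn -/M; ring.
have base t : 0 <= t -> t <= rho ->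
    sector_norm theta t (X 1%N - X 0%N) <= t ^+ (n + q) /\
    sector_norm theta t (Y 1%N - Y 0%N) <= t ^+ (n + 2 * q).
  move=> t_ge0 trho; rewrite X1E Y1E.
  have t1 : 2 * t <= 2.
    by rewrite -[X in _ <= X]mulr1 ler_wpM2l // (le_trans trho) // (le_trans rho_t0).
  have aux b (P : {poly R}) : 2 ^+ b.+1 * l1norm 2 P <= a ->
      sector_norm theta t (- ('X^(b.+1) * P)) <= t ^+ b.
    move=> ba; rewrite /sector_norm /taylor_norm -scaleN1r comp_polyZ scaleN1r l1normN.
    apply: (le_trans (sector_norm_mulXn _ _ theta_ge0 theta_le1 t_ge0)).
    apply: (@le_trans _ _ (2 ^+ b.+1 * t ^+ b.+1 * l1norm 2 P)).
      rewrite ler_wpM2l ?l1norm_le ?mulr_ge0 // ?exprn_ge0 //.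
    have -> : 2 ^+ b.+1 * t ^+ b.+1 * l1norm 2 P =
      t ^+ b * (2 ^+ b.+1 * l1norm 2 P * t) by rewrite (exprS t); ring.
    by rewrite ler_piMr ?exprn_ge0 // small.
  by split; apply: aux; rewrite -/a1 -/a2 /a; lra.
have init t : 0 <= t -> t <= rho ->
    sector_norm theta t (X 0%N) + t ^+ n <= Q * t ^+ kappa /\
    sector_norm theta t (Y 0%N) + t ^+ (n + q) <= Q * t ^+ (kappa + q).
  move=> t_ge0 trho.
  have t1 : t <= 1 by rewrite (le_trans trho) // (le_trans rho_t0).
  have t2 : 2 * t <= 1 by apply: small => //; rewrite /a; lra.
  have aux b k (P : {poly R}) z : 2 * l1norm 1 P <= a -> `|P`_0| <= z ->
      2 ^+ b * (z + 1) + 1 <= Q -> (b <= k)%N ->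
      sector_norm theta t ('X^b * P) + t ^+ k <= Q * t ^+ b.
    move=> Pa Pz bQ bk.
    apply: (@le_trans _ _ ((2 ^+ b * (z + 1) + 1) * t ^+ b)); last first.
      by rewrite ler_wpM2r // exprn_ge0.
    rewrite mulrDl mul1r; apply: lerD; last first.
      by rewrite -(subnKC bk) exprD ler_piMr ?exprn_ge0 // exprn_ile1.
    apply: (le_trans (sector_norm_mulXn _ _ theta_ge0 theta_le1 t_ge0)).
    rewrite mulrAC ler_wpM2r ?exprn_ge0 // ler_wpM2l ?(ltW (p2 _)) //.
    apply: (le_trans (l1norm_le_coef0 _ t_ge0 t2)); apply: lerD => //.
    exact: small.
  split.
    apply: (aux _ _ _ 1) => //.
    - by rewrite -/a3 /a; lra.
    - by rewrite X00 normr1.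
    - rewrite /Q lerD2r; apply: ler_pM; rewrite ?(ltW (p2 _)) //; last by lra.
      by apply: ler_weXn2l; rewrite ?leq_addr // ler1n.
    exact: ltnW.
  apply: (aux _ _ _ `|y0|).
  - by rewrite -/a4 /a; lra.
  - by rewrite Y00.
  - by rewrite /Q lerD2r ler_wpM2l ?(ltW (p2 _)) //; lra.
  by rewrite leq_add2r ltnW.
have tail t : 0 <= t -> t <= rho -> (Q * t / e) ^+ m0 * S <= t ^+ (n + 2 * q).
  move=> t_ge0 trho; have t1 : t <= 1 by rewrite (le_trans trho) // (le_trans rho_t0).
  have -> : (Q * t / e) ^+ m0 * S = t ^+ m0 * a5.
    by rewrite /a5 mulrAC (mulrC _ t) exprMn; ring.
  apply: (@le_trans _ _ (t ^+ (n + 2 * q).+1 * a5)).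
    rewrite ler_wpM2r // -(subnKC nm0) exprD ler_piMr ?exprn_ge0 // exprn_ile1 //.
  rewrite exprSr -mulrA ler_piMr ?exprn_ge0 // mulrC small // /a; lra.
have incr := backward_iter_increments kappa_gt0 C_weight e_gt0 theta_ge0 (ltW c_gt0)
  C_summable Q1 t0_gt0 t0_le1 Qt0 rho_t0 nu_ge F_bounds base init tail.
have norm_le := backward_iter_norm_le kappa_gt0 C_weight e_gt0 theta_ge0 (ltW c_gt0)
  C_summable Q1 t0_gt0 t0_le1 Qt0 rho_t0 nu_ge F_bounds base init tail.
exists theta, (rho / 2), d, Q, L, n, m0, X0, Y0, X, Y => /=; rewrite -/F.
have rho2 : rho / 2 <= rho by lra.
split => //.
- split => //; first by rewrite divr_gt0 //= (le_trans rho2) ?(le_trans rho_t0).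
    have := small a6 rho (ltW rho_gt0) (lexx _) ltac:(rewrite /a; lra).
    rewrite /a6 mulrAC ler_pdivrMr // mul1r; have := mulr_gt0 Q0 rho_gt0; lra.
  have := small a7 rho (ltW rho_gt0) (lexx _) ltac:(rewrite /a; lra).
  rewrite /a7 mulrAC ler_pdivrMr // mul1r; have := mulr_gt0 Q0 rho_gt0; lra.
- by move=> m; split; [exact: backward_iterSX|exact: backward_iterSY].
- move=> t t_ge0 trho.
  by have [] := Fb t t_ge0 (le_trans trho (le_trans rho2 rho_rho1)).
move=> t t_ge0 trho; have {}trho := le_trans trho rho2.
split.
- by move=> j; case: (incr j t t_ge0 trho).
- by move=> j; case: (incr j t t_ge0 trho).
- by move=> m; exact: norm_le.
move=> p A B A' B' hA hA' hB hB'.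
have tt0 := le_trans trho rho_t0.
(* A constant polynomial has its absolute value as sector norm, so the numerical Lipschitz bound is
   a special case. *)
have := @trunc_series_lipschitz _ kappa q C e S Q t0 theta kappa_gt0 C_weight e_gt0
  theta_ge0 C_summable Q1 t0_gt0 t0_le1 Qt0 p t A%:P B%:P A'%:P B'%:P t_ge0 tt0.
rewrite !sector_normC => /(_ hA hA' hB hB').
have truncC x y : trunc_series C p x%:P y%:P =
    (\sum_(i < p) \sum_(j < p) C i j * x ^+ i * y ^+ j)%:P.
  rewrite /trunc_series rmorph_sum; apply: eq_bigr => i _.
  rewrite rmorph_sum; apply: eq_bigr => j _.
  by rewrite -!rmorphXn -!rmorphM mulrA.
rewrite !truncC -!polyCB !sector_normC => /le_trans; apply.
rewrite -/L ler_wpM2l //; have t1 := le_trans tt0 t0_le1.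
by apply: lerD; rewrite ler_piMl // exprn_ile1.
Qed.

End ApproximationExists.

(** * The limiting curve *)

Lemma normr_horner_le_sector_norm (R : realType) (theta t : R) (P : {poly R}) :
  0 <= theta -> 0 <= t -> `|P.[t]| <= sector_norm theta t P.
Proof.
move=> th0 t0; have -> : P.[t] = (P \Po ('X + t%:P)).[0].
  by rewrite horner_comp !hornerE.
by apply: normr_horner_le; rewrite normr0 mulr_ge0.
Qed.

Lemma within_dist_cvg (R : realType) (A : set R) (f : R -> R) (x l : R) :
  (forall eps, 0 < eps -> exists2 eta, 0 < eta &
     forall s, A s -> `|s - x| < eta -> `|l - f s| <= eps) ->
  f s @[s --> within A (nbhs x)] --> l.
Proof.
move=> H; apply/cvgrPdist_le => eps /H[eta eta0 Heta].
apply/nbhs_ballP; exists eta => //= s; rewrite /ball /= => xs As.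
by apply: Heta; rewrite 1?distrC.
Qed.

Lemma within_dist_cvg_dnbhs (R : realType) (A : set R) (f : R -> R) (x l : R) :
  (forall eps, 0 < eps -> exists2 eta, 0 < eta &
     forall s, A s -> s != x -> `|s - x| < eta -> `|l - f s| <= eps) ->
  f s @[s --> within A x^'] --> l.
Proof.
move=> H; apply/cvgrPdist_le => eps /H[eta eta0 Heta].
apply/nbhs_ballP; exists eta => //= s; rewrite /ball /= => xs sx As.
by apply: Heta; rewrite 1?distrC.
Qed.

Section SectorialLimit.
Context {R : realType}.
Variables (P : nat -> {poly R}) (theta rho : R) (n : nat).
Hypotheses (theta_gt0 : 0 < theta) (n_gt1 : (1 < n)%N).
Hypothesis P_bounded : forall t, 0 <= t -> t <= rho ->
  forall j, \sum_(m < j) sector_norm theta t (P m.+1 - P m) <= t ^+ n.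

Definition sector_lim (x : R) : R := limn (fun m => (P m).[x]).

(** At [0] the disc of radius [theta t] degenerates. There the limit agrees with [P 0] up to [t^n]
    with [n > 1], so the derivative is that of [P 0]. *)
Definition sector_lim_derive (x : R) : R :=
  if x == 0 then (P 0)^`().[0] else limn (fun m => (P m \Po ('X + x%:P))`_1).

Let phi := sector_lim.
Let dphi := sector_lim_derive.

Lemma sector_lim_cvg t : 0 <= t -> t <= rho -> (P m).[t] @[m --> \oo] --> phi t.
Proof.
move=> t0 trho; rewrite -[t]addr0.
by apply: (poly_lim_cvg _ (P_bounded t0 trho)); rewrite ?normr0 mulr_ge0 // ltW.
Qed.

Lemma sector_lim_dist t : 0 <= t -> t <= rho -> `|phi t - (P 0).[t]| <= t ^+ n.
Proof.
move=> t0 trho; rewrite -{1 2}[t]addr0.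
by apply: (poly_lim_dist _ (P_bounded t0 trho)); rewrite ?normr0 mulr_ge0 // ltW.
Qed.

Lemma sector_lim_analytic t : 0 < t -> t <= rho -> analytic_at1 phi t.
Proof.
move=> t0 trho; have tt : 0 < theta * t by rewrite mulr_gt0.
exists (fun i => limn (fun m => (P m \Po ('X + t%:P))`_i)), (theta * t).
split => // h /ltW ht.
exact: (poly_lim_pseries (ltW tt) (P_bounded (ltW t0) trho) tt ht).
Qed.

Let B := l1norm ((1 + theta) * rho) (P 0) + rho ^+ n.

(** Radius and constant serve for all base points [t >= a]; continuity of the derivative away from
    [0] rests on this uniformity. *)
Let sector_lim_linear t a h : 0 < a -> a <= t -> t <= rho -> `|h| <= theta * a ->
  `|phi (t + h) - phi t - dphi t * h| <= B / (theta * a) ^+ 2 * `|h| ^+ 2.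
Proof.
move=> a0 at_ trho ha; have t0 : 0 < t by exact: lt_le_trans at_.
have rho0 : 0 < rho by exact: lt_le_trans trho.
have tt : 0 < theta * t by rewrite mulr_gt0.
have aa : 0 < theta * a by rewrite mulr_gt0.
have ht : `|h| <= theta * t by apply: le_trans ha _; rewrite ler_pM2l.
have := poly_lim_linear (ltW tt) (P_bounded (ltW t0) trho) tt ht.
rewrite /dphi /sector_lim_derive gt_eqF // => /le_trans; apply.
rewrite expr_div_n mulrA mulrAC ler_wpM2r ?sqr_ge0 //; apply: ler_pM.
- by rewrite addr_ge0 ?exprn_ge0 ?(ltW t0) // l1norm_ge0 // ltW.
- by rewrite invr_ge0 sqr_ge0.
- apply: lerD; last by apply: lerXn2r; rewrite ?nnegrE ?(ltW t0) ?(ltW rho0).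
  apply: (le_trans (sector_norm_le_l1norm _ _ _));
    rewrite ?(ltW theta_gt0) ?(ltW t0) //.
  have th1 : 0 <= 1 + theta by rewrite addr_ge0 // ltW.
  by apply: l1norm_le; rewrite ?ler_wpM2l // mulr_ge0 // ltW.
rewrite lef_pV2 ?posrE ?exprn_gt0 //.
by apply: lerXn2r; rewrite ?nnegrE ?(ltW tt) ?(ltW aa) // ler_pM2l.
Qed.

Let B_ge0 : 0 <= rho -> 0 <= B.
Proof.
move=> rho0; have th1 : 0 <= 1 + theta by rewrite addr_ge0 // ltW.
by rewrite addr_ge0 ?exprn_ge0 // l1norm_ge0 // mulr_ge0.
Qed.

Let sector_lim_linear0 : exists2 M : R, 0 <= M & forall s, 0 <= s -> s <= rho ->
  s <= 1 -> `|phi s - phi 0 - dphi 0 * s| <= M * s ^+ 2.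
Proof.
exists (1 + l1norm 1 (P 0)); first by rewrite addr_ge0 // l1norm_ge0.
move=> s s0 srho s1.
have phi0 : phi 0 = (P 0).[0].
  apply/eqP; rewrite -subr_eq0 -normr_le0.
  rewrite (le_trans (sector_lim_dist (lexx _) (le_trans s0 srho))) //.
  by rewrite expr0n gtn_eqF // ltnW.
have := horner_sub_linear_le (P 0) (@ltr01 R) (_ : `|s| <= 1).
rewrite ger0_norm // divr1 => /(_ s1) h1.
have h2 := sector_lim_dist s0 srho.
rewrite /dphi /sector_lim_derive eqxx.
have -> : (P 0)^`().[0] = (P 0)`_1 by rewrite horner_coef0 coef_deriv mulr1n.
rewrite phi0.
have -> : phi s - (P 0).[0] - (P 0)`_1 * s = (phi s - (P 0).[s]) +
  ((P 0).[s] - (P 0).[0] - (P 0)`_1 * s) by ring.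
rewrite (le_trans (ler_normD _ _)) // mulrDl mul1r; apply: lerD => //.
apply: (le_trans h2); rewrite -(subnKC n_gt1) exprD ler_piMr ?exprn_ge0 //.
by rewrite exprn_ile1.
Qed.

Let sector_lim_quadratic t : 0 <= t -> t < rho -> exists (M eta : R),
  [/\ 0 <= M, 0 < eta & forall s, 0 <= s -> s < rho -> `|s - t| < eta ->
    `|phi s - phi t - dphi t * (s - t)| <= M * `|s - t| ^+ 2].
Proof.
rewrite le_eqVlt => /predU1P[<- rho0|t0 trho].
  have [M M0 HM] := sector_lim_linear0.
  exists M, 1; split => // s s0 srho; rewrite subr0 ger0_norm // => s1.
  by apply: HM => //; exact: ltW.
have tt : 0 < theta * t by rewrite mulr_gt0.
exists (B / (theta * t) ^+ 2), (theta * t); split => //.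
  by rewrite divr_ge0 ?sqr_ge0 // B_ge0 // ltW // (lt_trans t0).
move=> s s0 srho st.
have := sector_lim_linear t0 (lexx t) (ltW trho) (ltW st).
by rewrite (addrC t) subrK.
Qed.

Lemma sector_lim_derivable t : 0 <= t -> t < rho ->
  (s - t)^-1 * (phi s - phi t) @[s --> within `[0, rho[ t^'] --> dphi t.
Proof.
move=> t0 trho; have [M [eta [M0 eta0 H]]] := sector_lim_quadratic t0 trho.
apply: within_dist_cvg_dnbhs => eps eps0.
exists (Num.min eta (eps / (M + 1))).
  by rewrite lt_min eta0 divr_gt0 // ltr_wpDl.
move=> s /=; rewrite in_itv /= => /andP[s0 srho] st; rewrite lt_min => /andP[h1 h2].
have st0 : s - t != 0 by rewrite subr_eq0.
have -> : dphi t - (s - t)^-1 * (phi s - phi t) =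
    - ((s - t)^-1 * (phi s - phi t - dphi t * (s - t))) by field.
rewrite normrN normrM normfV ler_pdivrMl ?normr_gt0 //.
apply: (le_trans (H s s0 srho h1)); rewrite expr2 mulrA mulrC ler_wpM2l //.
move: h2; rewrite ltr_pdivlMr ?ltr_wpDl // => /ltW; apply: le_trans.
by rewrite mulrC ler_wpM2l // lerDl.
Qed.

(** Near [0], the derivative differs from that of [P 0] by at most [t^n / (theta t)]. At [t > 0],
    the expansions from [t] to [s] and from [s] to [t] are added: the values cancel, and the
    difference of the derivatives times [s - t] is at most [2 M |s - t|^2]. *)
Lemma sector_lim_derive_continuous t : 0 <= t -> t < rho ->
  dphi s @[s --> within `[0, rho[ (nbhs t)] --> dphi t.
Proof.
rewrite le_eqVlt => /predU1P[<- rho0|t0 trho].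
  apply: within_dist_cvg => eps eps0.
  have e2 : 0 < eps / 2 by rewrite divr_gt0.
  have /cvgrPdist_le/(_ _ e2)/nbhs_ballP[eta /= eta0 Heta] :
    (P 0)^`().[s] @[s --> (0 : R)] --> (P 0)^`().[0] by exact: continuous_horner.
  exists (Num.min 1 (Num.min eta (theta * (eps / 2)))).
    by rewrite !lt_min ltr01 eta0 mulr_gt0.
  move=> s /=; rewrite in_itv /= => /andP[s0 srho]; rewrite subr0 ger0_norm //.
  rewrite !lt_min => /and3P[s1 seta sth].
  have [->|sN0] := eqVneq s 0; first by rewrite subrr normr0 ltW.
  have s_gt0 : 0 < s by rewrite lt_neqAle eq_sym sN0.
  have ss : 0 < theta * s by rewrite mulr_gt0.
  have h1 := poly_lim_derive_dist (ltW ss) (P_bounded s0 (ltW srho)) ss.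
  have h2 := Heta s; rewrite /ball /= sub0r normrN ger0_norm // in h2.
  have {}h2 := h2 seta.
  have h3 : `|dphi s - (P 0)^`().[s]| <= eps / 2.
    rewrite /dphi /sector_lim_derive (negbTE sN0).
    move: h1; rewrite -ler_pdivlMr // => /le_trans; apply.
    rewrite ler_pdivrMr // mulrA -(prednK (ltnW n_gt1)) exprSr ler_wpM2r //.
    apply: (@le_trans _ _ s); last by rewrite mulrC ltW.
    rewrite -(prednK (_ : 0 < n.-1)%N) ?exprS; last by rewrite -ltnS prednK // ltnW.
    by rewrite ler_piMr // exprn_ile1 // ltW.
  have -> : dphi 0 = (P 0)^`().[0] by rewrite /dphi /sector_lim_derive eqxx.
  have -> : (P 0)^`().[0] - dphi s = ((P 0)^`().[0] - (P 0)^`().[s]) -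
    (dphi s - (P 0)^`().[s]) by ring.
  rewrite (le_trans (ler_normB _ _)) //; lra.
apply: within_dist_cvg => eps eps0.
pose a := t / 2; have a0 : 0 < a by rewrite divr_gt0.
have tha : 0 < theta * a by rewrite mulr_gt0.
pose M := B / (theta * a) ^+ 2.
have M0 : 0 <= M.
  exact: divr_ge0 (B_ge0 (ltW (lt_trans t0 trho))) (sqr_ge0 _).
have M21 : 0 < 2 * M + 1 := ltr_wpDl (mulr_ge0 (ler0n _ 2) M0) ltr01.
exists (Num.min a (Num.min (theta * a) (eps / (2 * M + 1)))).
  by rewrite !lt_min a0 tha divr_gt0.
move=> s /=; rewrite in_itv /= => /andP[s0 srho]; rewrite !lt_min => /and3P[h1 h2 h3].
have at_ : a <= t by rewrite /a; lra.
have as_ : a <= s.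
  by move: h1; rewrite ltr_norml => /andP[h1 _]; rewrite /a in h1 *; lra.
have [->|sN] := eqVneq s t; first by rewrite subrr normr0 ltW.
have st0 : 0 < `|s - t| by rewrite normr_gt0 subr_eq0.
have H1 := sector_lim_linear a0 at_ (ltW trho) (ltW h2).
have H2 : `|t - s| <= theta * a by rewrite distrC ltW.
have {}H2 := sector_lim_linear a0 as_ (ltW srho) H2.
rewrite (addrC t) subrK -/M in H1; rewrite (addrC s) subrK (distrC t s) -/M in H2.
rewrite -(ler_pM2r st0) -normrM.
have -> : (dphi t - dphi s) * (s - t) =
  - ((phi s - phi t - dphi t * (s - t)) + (phi t - phi s - dphi s * (t - s))) by ring.
rewrite normrN (le_trans (ler_normD _ _)) //.
apply: (le_trans (lerD H1 H2)).
have -> : M * `|s - t| ^+ 2 + M * `|s - t| ^+ 2 = 2 * M * `|s - t| * `|s - t| by ring.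
rewrite ler_pM2r //.
move: h3; rewrite ltr_pdivlMr // => /ltW; apply: le_trans.
by rewrite [X in _ <= X]mulrC ler_wpM2r // lerDl.
Qed.

End SectorialLimit.

Lemma horner_sub_coef0_le (R : realType) (P : {poly R}) (t : R) :
  0 <= t -> t <= 1 -> `|P.[t] - P`_0| <= l1norm 1 P * t.
Proof.
move=> t0 t1; rewrite (@horner_coef_wide _ (size P).+1) ?leqnSn //.
rewrite big_ord_recl expr0 mulr1 addrAC subrr add0r.
rewrite (@l1norm_widen _ _ _ (size P).+1) ?leqnSn // big_ord_recl mulrDl.
rewrite (le_trans (ler_norm_sum _ _ _)) // ler_wpDl //.
  by rewrite !mulr_ge0 ?exprn_ge0.
rewrite mulr_suml; apply: ler_sum => i _.
rewrite expr1n mulr1 normrM normrX (ger0_norm t0) ler_wpM2l //.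
by rewrite exprS ler_piMr // exprn_ile1.
Qed.

Lemma leading_term_le (R : realType) (P : {poly R}) (x y t : R) (k n : nat) :
  0 <= t -> t <= 1 -> P`_0 = y -> (k < n)%N ->
  `|x - ('X^k * P).[t]| <= t ^+ n ->
  `|x - y * t ^+ k| <= (1 + l1norm 1 P) * t ^+ k.+1.
Proof.
move=> t0 t1 P0 kn; rewrite hornerM hornerXn => h.
have -> : x - y * t ^+ k = (x - t ^+ k * P.[t]) + t ^+ k * (P.[t] - P`_0).
  by rewrite P0; ring.
rewrite (le_trans (ler_normD _ _)) // mulrDl mul1r; apply: lerD.
  by rewrite (le_trans h) // -(subnKC kn) exprD ler_piMr ?exprn_ge0 // exprn_ile1.
rewrite normrM normrX (ger0_norm t0) exprSr mulrCA ler_wpM2l ?exprn_ge0 //.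
exact: horner_sub_coef0_le.
Qed.

(** * The invariance equation in the limit *)

Section InvariantCurve.
Context {R : realType}.
Variables (kappa q m1 : nat) (c r y0 e S delta : R) (C : nat -> nat -> R).
Variable f : R * R -> R.
Hypotheses (q_gt0 : (0 < q)%N) (kappa_gt0 : (0 < kappa)%N).
Hypothesis C_weight :
  forall i j, C i j != 0 -> (kappa + 2 * q <= weight kappa q i j)%N.
Hypotheses (e_gt0 : 0 < e) (delta_gt0 : 0 < delta) (r_lt0 : r < 0) (c_gt0 : 0 < c).
Hypothesis C_summable : forall p, square_sum C e p <= S.
Hypothesis cy0 : c * y0 = kappa%:R * r.
Hypothesis lead_balance : forall m, (m1 <= m)%N ->
  lead_sum kappa q C m (fun i j => y0 ^+ j) = (kappa + q)%:R * y0 * r.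
Hypothesis lead_slope : forall m, (m1 <= m)%N ->
  r * q.+1%:R <= lead_sum kappa q C m (fun i j => j%:R * y0 ^+ j.-1).
Hypothesis f_sum : forall h : R * R, `|h| < e ->
  (fun n => \sum_(i < n) \sum_(j < n) C i j * h.1 ^+ i * h.2 ^+ j) @ \oo --> f h.

(** The recursion evaluated at [t] involves the iterates at [t] and at [P(t)], which stays in
    [[0, rho]]; all terms converge, and uniqueness of limits gives invariance. The asymptotics
    follow from the distance [t^n], resp. [t^(n + q)], to the initial polynomials, since
    [n > kappa]. *)
Lemma invariant_curve :
  exists (rho d B : R) (K : R -> R * R),
  let F := inner_map q r d in
  [/\ 0 < rho <= 1, C1_curve rho K, analytic_curve rho K,
      forall t, 0 <= t -> t < rho ->
        `|(K t).1 - t ^+ kappa| <= B * t ^+ kappa.+1 /\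
        `|(K t).2 - y0 * t ^+ (kappa + q)| <= B * t ^+ (kappa + q).+1 &
      forall t, 0 <= t -> t < rho ->
        [/\ `|K t| < delta, 0 <= F.[t] < rho,
            (K F.[t]).1 = (K t).1 + c * (K t).2 &
            (K F.[t]).2 = (K t).2 + f (K t)]].
Proof.
have [theta [rho [d [Q [L [n [m0 [X0 [Y0 [X [Y H]]]]]]]]]]] :=
  @parabolic_approximations R kappa q m1 c r y0 e S delta C q_gt0 kappa_gt0
    C_weight e_gt0 delta_gt0 r_lt0 c_gt0 C_summable cy0 lead_balance lead_slope.
move: H => /= [[theta_gt0 /andP[rho_gt0 rho_le1] Q1 Qe Qd]
  [XE YE X00 Y00 kn] rec F_le bnds].
set F := inner_map q r d in rec F_le *.
have n1 : (1 < n)%N by exact: leq_trans kn.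
have nq1 : (1 < n + q)%N by rewrite (leq_trans n1) // leq_addr.
have Xb t : 0 <= t -> t <= rho ->
    forall j, \sum_(m < j) sector_norm theta t (X m.+1 - X m) <= t ^+ n.
  by move=> t0 trho; have [] := bnds t t0 trho.
have Yb t : 0 <= t -> t <= rho ->
    forall j, \sum_(m < j) sector_norm theta t (Y m.+1 - Y m) <= t ^+ (n + q).
  by move=> t0 trho; have [] := bnds t t0 trho.
pose K t := (sector_lim X t, sector_lim Y t).
have Kbound t : 0 <= t -> t <= rho -> [/\ `|(K t).1| <= Q * t ^+ kappa,
    `|(K t).2| <= Q * t ^+ (kappa + q) & `|K t| <= Q * rho].
  move=> t0 trho; have [_ _ le_norm _] := bnds t t0 trho.
  have aux (P : nat -> {poly R}) b :
      (P m).[t] @[m --> \oo] --> sector_lim P t ->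
      (forall m, sector_norm theta t (P m) <= b) -> `|sector_lim P t| <= b.
    move=> Pt Pm; have nPt : `|(P m).[t]| @[m --> \oo] --> `|sector_lim P t|.
      exact: cvg_norm.
    rewrite -(cvg_lim (@Rhausdorff R) nPt); apply: limr_le.
      by apply/cvg_ex; eexists; exact: nPt.
    exists 0%N => // m _ /=; apply: le_trans (Pm m).
    by apply: normr_horner_le_sector_norm => //; exact: ltW.
  have h1 : `|(K t).1| <= Q * t ^+ kappa.
    apply: aux => [|m]; last by have [] := le_norm m.
    exact: (sector_lim_cvg theta_gt0 Xb).
  have h2 : `|(K t).2| <= Q * t ^+ (kappa + q).
    apply: aux => [|m]; last by have [] := le_norm m.
    exact: (sector_lim_cvg theta_gt0 Yb).
  have pow_le k : (0 < k)%N -> Q * t ^+ k <= Q * rho.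
    move=> k0; rewrite ler_wpM2l ?(le_trans _ Q1) //.
    rewrite -(prednK k0) exprS (le_trans _ trho) // ler_piMr //.
    by rewrite exprn_ile1 // (le_trans trho).
  split => //; rewrite prod_normE ge_max.
  by rewrite (le_trans h1) ?(le_trans h2) ?pow_le // addn_gt0 kappa_gt0.
exists rho, d, ((1 + l1norm 1 X0) + (1 + l1norm 1 Y0)), K => /=; rewrite -/F.
have lX0 : 0 <= 1 + l1norm 1 X0 by rewrite addr_ge0 // l1norm_ge0.
have lY0 : 0 <= 1 + l1norm 1 Y0 by rewrite addr_ge0 // l1norm_ge0.
split.
- by rewrite rho_gt0.
- exists (fun t => (sector_lim_derive X t, sector_lim_derive Y t)); split.
    apply/subspace_continuousP => t; rewrite /= in_itv /= => /andP[t0 trho].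
    have h1 := sector_lim_derive_continuous theta_gt0 n1 Xb t0 trho.
    have h2 := sector_lim_derive_continuous theta_gt0 nq1 Yb t0 trho.
    exact: (cvg_pair h1 h2).
  move=> t; rewrite in_itv /= => /andP[t0 trho].
  have h1 := sector_lim_derivable theta_gt0 n1 Xb t0 trho.
  have h2 := sector_lim_derivable theta_gt0 nq1 Yb t0 trho.
  exact: (cvg_pair h1 h2).
- move=> t; rewrite in_itv /= => /andP[t0 trho]; split.
    exact: (sector_lim_analytic theta_gt0 Xb t0 (ltW trho)).
  exact: (sector_lim_analytic theta_gt0 Yb t0 (ltW trho)).
- move=> t t0 trho; have t1 : t <= 1 by rewrite (le_trans (ltW trho)).
  have hX := sector_lim_dist theta_gt0 Xb t0 (ltW trho).
  have hY := sector_lim_dist theta_gt0 Yb t0 (ltW trho).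
  rewrite XE in hX; rewrite YE in hY.
  have kqn : (kappa + q < n + q)%N by rewrite ltn_add2r.
  split; rewrite mulrDl.
    rewrite -[t ^+ kappa]mul1r (le_trans (leading_term_le t0 t1 X00 kn hX)) //.
    by rewrite lerDl mulr_ge0 ?exprn_ge0.
  rewrite (le_trans (leading_term_le t0 t1 Y00 kqn hY)) //.
  by rewrite lerDr mulr_ge0 ?exprn_ge0.
move=> t t0 trho; have trho' := ltW trho.
have [F0 Ft] := F_le t t0 trho'.
have [KX KY Kn] := Kbound t t0 trho'.
have Frho : F.[t] <= rho by exact: le_trans trho'.
have cX := sector_lim_cvg theta_gt0 Xb t0 trho'.
have cY := sector_lim_cvg theta_gt0 Yb t0 trho'.
have cXF := sector_lim_cvg theta_gt0 Xb F0 Frho.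
have cYF := sector_lim_cvg theta_gt0 Yb F0 Frho.
have shift (u : nat -> R) (l : R) : u @ \oo --> l -> u m.+1 @[m --> \oo] --> l.
  by move=> ul; have := cvg_shiftS u (nbhs l) => ->.
split.
- exact: le_lt_trans Qd.
- by rewrite F0 (le_lt_trans Ft).
- have cXS := shift _ _ cX; apply/eqP; rewrite -subr_eq; apply/eqP.
  have : (X m \Po F - c%:P * Y m).[t] @[m --> \oo] -->
      sector_lim X F.[t] - c * sector_lim Y t.
    under eq_fun do rewrite hornerD hornerN hornerM hornerC horner_comp.
    by apply: cvgB => //; apply: cvgM => //; exact: cvg_cst.
  under eq_fun do rewrite -(proj1 (rec _)).
  by move=> h; exact: (cvg_unique _ h cXS).
have cYS := shift _ _ cY.
pose T m x y := \sum_(i < m) \sum_(j < m) C i j * x ^+ i * y ^+ j.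
have T_eval m (A B : {poly R}) : (trunc_series C m A B).[t] = T m A.[t] B.[t].
  rewrite /trunc_series horner_sum; apply: eq_bigr => i _.
  rewrite horner_sum; apply: eq_bigr => j _.
  by rewrite !hornerM hornerC !horner_exp mulrA.
have TK : T (m0 + m)%N (K t).1 (K t).2 @[m --> \oo] --> f (K t).
  have := f_sum (le_lt_trans Kn Qe) => h.
  have hS : T (m + m0)%N (K t).1 (K t).2 @[m --> \oo] --> f (K t).
    by have := cvg_shiftn m0 (fun m => T m (K t).1 (K t).2) (nbhs (f (K t))) => ->.
  rewrite (_ : (fun m => _) = (fun m => T (m + m0)%N (K t).1 (K t).2)) //.
  by apply/funext => m; rewrite addnC.
(* Truncation order and arguments vary together; the Lipschitz constant [L], independent of the
   order, separates the two limits. *)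
have TXY : T (m0 + m)%N (X m).[t] (Y m).[t] @[m --> \oo] --> f (K t).
  have diff : T (m0 + m)%N (X m).[t] (Y m).[t] - T (m0 + m)%N (K t).1 (K t).2
      @[m --> \oo] --> (0 : R).
    pose b m := L * (`|(X m).[t] - (K t).1| + `|(Y m).[t] - (K t).2|).
    have b0 : b m @[m --> \oo] --> (0 : R).
      rewrite -(mulr0 L) -(addr0 (0 : R)) -(@normr0 _ R).
      apply: cvgM; first exact: cvg_cst.
      apply: cvgD; apply: cvg_norm.
        by rewrite -(subrr (K t).1); apply: cvgB => //; exact: cvg_cst.
      by rewrite -(subrr (K t).2); apply: cvgB => //; exact: cvg_cst.
    apply: (@squeeze_cvgr _ _ _ _ (fun m => - b m) b) => //; last first.
      by rewrite -oppr0; exact: cvgN.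
    exists 0%N => // m _ /=; rewrite -ler_norml.
    have [_ _ le_norm lip] := bnds t t0 trho'; have [lX lY] := le_norm m.
    apply: lip => //.
    + by apply: le_trans lX; apply: normr_horner_le_sector_norm => //; exact: ltW.
    + by apply: le_trans lY; apply: normr_horner_le_sector_norm => //; exact: ltW.
  rewrite -[f _]add0r (_ : (fun m => _) = (fun m =>
    (T (m0 + m)%N (X m).[t] (Y m).[t] - T (m0 + m)%N (K t).1 (K t).2) +
     T (m0 + m)%N (K t).1 (K t).2)); first exact: cvgD.
  by apply/funext => m; rewrite subrK.
apply/eqP; rewrite -subr_eq; apply/eqP.
have : (Y m \Po F - trunc_series C (m0 + m) (X m) (Y m)).[t] @[m --> \oo] -->
    sector_lim Y F.[t] - f (K t).
  under eq_fun do rewrite hornerD hornerN horner_comp T_eval.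
  exact: cvgB.
under eq_fun do rewrite -(proj2 (rec _)).
by move=> h; exact: (cvg_unique _ h cYS).
Qed.

End InvariantCurve.

(** * Reduced forms *)

Lemma square_sum_bounded (R : realType) (C : nat -> nat -> R) (e : R) : 0 < e ->
  summable [set: nat * nat] (fun ij => (C ij.1 ij.2 * e ^+ (ij.1 + ij.2))%:E) ->
  exists S, forall p, square_sum C e p <= S.
Proof.
move=> e0; rewrite summableE => fin.
exists (fine (\esum_(ij in [set: nat * nat])
  `|(C ij.1 ij.2 * e ^+ (ij.1 + ij.2))%:E|)%E).
move=> p; rewrite -lee_fin fineK //; apply: esum_ge.
exists (`I_p `*` `I_p).
  by split => //; apply: finite_setX; exact: finite_II.
rewrite -(pair_fsbig _ (fun i j => `|(C i j * e ^+ (i + j))%:E|%E)) ?finite_II //.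
rewrite -(fsbig_ord _ _ (fun i => \sum_(j \in `I_p) `|(C i j * e ^+ (i + j))%:E|%E)).
rewrite /square_sum -sumEFin; apply: lee_sum => i _.
rewrite -(fsbig_ord _ _ (fun j => `|(C i j * e ^+ (i + j))%:E|%E)) -sumEFin.
apply: lee_sum => j _.
by rewrite /= lee_fin normrM (ger0_norm (exprn_ge0 _ (ltW e0))).
Qed.

Lemma coef_shifted_sum (R : realType) (k r s : nat) (a : nat -> R) : (k <= r)%N ->
  ('X^s * \sum_(k <= j < r.+1) a j *: 'X^(j - k))`_s = a k.
Proof.
move=> kr; rewrite coefXnM ltnn subnn big_ltn ?ltnS // coefD coefZ subnn expr0.
rewrite coef1 eqxx mulr1 coef_sum big_nat big1 ?addr0 // => j /andP[kj _].
by rewrite coefZ coefXn eq_sym subn_eq0 leqNgt kj mulr0.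
Qed.

Lemma sum_delta2 (R : realType) (m i0 j0 : nat) (x : R) : (i0 < m)%N -> (j0 < m)%N ->
  \sum_(i < m) \sum_(j < m) (if (i == i0 :> nat) && (j == j0 :> nat) then x else 0) = x.
Proof.
move=> im jm; rewrite (bigD1 (Ordinal im)) //= (bigD1 (Ordinal jm)) //= !eqxx.
rewrite [X in _ + X + _]big1 => [|j jN]; last by rewrite ifF //; apply: negbTE.
rewrite big1 ?addr0 // => i iN; apply: big1 => j _.
by rewrite ifF // -[_ == i0]/(i == Ordinal im) (negbTE iN).
Qed.

(** * Weights of the monomials of a reduced form *)

Section LeadingPart.
Context {R : realType}.
Variables (kappa q k l : nat) (C : nat -> nat -> R).
Hypothesis kappa_gt0 : (0 < kappa)%N.
Hypothesis weight_k : (kappa + 2 * q <= kappa * k)%N.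
Hypothesis weight_l : (q <= kappa * l.-1)%N.
Hypothesis C0 : forall i, (i < k)%N -> C i 0 = 0.
Hypothesis C1 : forall i, (i < l.-1)%N -> C i 1 = 0.

(** A factor [y^2] alone has weight [2 (kappa + q) >= kappa + 2 q]; the vanishing of coefficients is
    needed only for the monomials [x^i] and [x^i y]. *)
Lemma reduced_weight i j : C i j != 0 -> (kappa + 2 * q <= weight kappa q i j)%N.
Proof.
case: j => [|[|j]] Cij; rewrite /weight.
- have ki : (k <= i)%N by case: leqP => // /C0 E; rewrite E eqxx in Cij.
  by rewrite muln0 addn0 (leq_trans weight_k) // leq_mul2l ki orbT.
- have li : (l.-1 <= i)%N by case: leqP => // /C1 E; rewrite E eqxx in Cij.
  have : (kappa * l.-1 <= kappa * i)%N by rewrite leq_mul2l li orbT.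
  move: weight_l; rewrite muln1; clear; lia.
clear; nia.
Qed.

(** Only [x^k] and [x^(l - 1) y] can attain the minimal weight: a larger exponent of [x] raises it
    strictly, and [y^2] exceeds it by [kappa]. *)
Lemma lead_sumE (E : nat -> nat -> R) m : (k < m)%N -> (l < m)%N -> (1 < m)%N ->
  lead_sum kappa q C m E =
  (if (kappa * k == kappa + 2 * q)%N then C k 0 * E k 0%N else 0) +
  (if (kappa * l.-1 == q)%N then C l.-1 1 * E l.-1 1%N else 0).
Proof.
move=> km lm m1.
rewrite -(@sum_delta2 _ m k 0 (if _ then _ else _)) //; last exact: ltnW.
rewrite -(@sum_delta2 _ m l.-1 1 (if (_ == q)%N then _ else _)) //; last first.
  by rewrite (leq_ltn_trans (leq_pred l)).
rewrite -big_split; apply: eq_bigr => i _; rewrite -big_split.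
apply: eq_bigr => j _ /=.
case: (nat_of_ord j) (nat_of_ord i) => [|[|j']] i'; rewrite ?andbT ?andbF ?addr0 ?add0r.
- have [->|ik] := eqVneq i' k; first by rewrite /weight muln0 addn0.
  case: eqP => // w; have [ki|ki] := ltnP i' k; first by rewrite C0 // mul0r.
  exfalso; have : (kappa * k < kappa * i')%N.
    by rewrite ltn_pmul2l // ltn_neqAle eq_sym ik.
  by move: w weight_k; rewrite /weight; clear; lia.
- have [->|il] := eqVneq i' l.-1.
    have -> : (weight kappa q l.-1 1 == kappa + 2 * q)%N = (kappa * l.-1 == q)%N.
      by rewrite /weight; clear; lia.
    by [].
  case: eqP => // w; have [li|li] := ltnP i' l.-1; first by rewrite C1 // mul0r.
  exfalso; have : (kappa * l.-1 < kappa * i')%N.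
    by rewrite ltn_pmul2l // ltn_neqAle eq_sym il.
  by move: w weight_l; rewrite /weight; clear; lia.
rewrite ifF //; apply/eqP; rewrite /weight; move: kappa_gt0; clear; nia.
Qed.

End LeadingPart.

Lemma reduced_form_coefs (R : realType) (k l r : nat)
    (a b : nat -> R) (u v : {poly {poly R}}) (f : R * R -> R) :
  (2 <= k <= r)%N -> (2 <= l <= r)%N -> u = 'X^2 * v ->
  taylor_polynomial f r ((p_poly k r a)%:P + 'X * (q_poly l r b)%:P + u) ->
  exists2 C : nat -> nat -> R, power_series_at2 f 0 C &
    [/\ forall i, (i < k)%N -> C i 0%N = 0, C k 0%N = a k,
        forall i, (i < l.-1)%N -> C i 1%N = 0 & C l.-1 1%N = b l].
Proof.
move=> /andP[k2 kr] /andP[l2 lr] -> [C fC CE]; exists C => //.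
have T0 i : (i <= r)%N -> C i 0%N = (p_poly k r a)`_i.
  move=> ir; have := CE i 0%N; rewrite addn0 ir => <-.
  by rewrite !coefD coefC eqxx coefXM (coefXnM _ v) /= !coef0 !addr0.
have T1 i : (i < r)%N -> C i 1%N = (q_poly l r b)`_i.
  move=> ir; have := CE i 1%N; rewrite addn1 ir => <-.
  by rewrite !coefD coefC /= coefXM (coefXnM _ v) /= !coef0 add0r addr0 coefC.
have l1r : (l.-1 < r)%N by rewrite prednK // (leq_trans _ l2).
split => [i ik||i il|].
- by rewrite T0 ?(leq_trans (ltnW ik)) // /p_poly coefXnM ik.
- by rewrite T0 // /p_poly coef_shifted_sum.
- by rewrite T1 ?(ltn_trans il) // /q_poly coefXnM il.
- by rewrite T1 // /q_poly coef_shifted_sum.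
Qed.

(** The three cases are the positions of the Newton polygon: the minimal weight is attained by [x^k]
    alone in case 1, by both monomials in case 2, by [x^(l - 1) y] alone in case 3. In case 1,
    [kappa = 2] keeps all exponents integral. *)
Lemma case_exponents (cs : reduced_case) (R : realType) (k l : nat) (a b : nat -> R) :
  (2 <= k)%N -> (2 <= l)%N -> in_case cs k l a b ->
  let kappa := xexp cs in let q := (case_N cs k l).-1 in
  [/\ (0 < q)%N, (0 < kappa)%N, (kappa + 2 * q <= kappa * k)%N,
      (q <= kappa * l.-1)%N & (kappa + q)%N = yexp cs k l].
Proof.
case: cs => /= k2 l2.
- by case=> kl _; split; move: k2 l2 kl; clear; lia.
- by case=> kl _ _; split; move: k2 l2 kl; clear; lia.
- by case=> kl _; split; move: k2 l2 kl; clear; lia.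
Qed.

(** With [c y0 = kappa rN], the balance is the quadratic equation
    [c (kappa + q) y0^2 / kappa = A + B y0], and [Ky] is its negative root. The last inequality
    reads [rN (q + 1) <= 0] in case 1, [- sqrt z <= b l] in case 2, and is an equality in case 3. *)
Lemma case_balance (cs : reduced_case) (R : realType) (c : R) (k l : nat)
    (a b : nat -> R) :
  (2 <= k)%N -> (2 <= l)%N -> 0 < c ->
  in_case cs k l a b -> sign_condition cs k l a b ->
  let kappa := xexp cs in let q := (case_N cs k l).-1 in
  let y0 := Ky cs c k l a b in let rN := R_N cs c k l a b in
  let A := if (kappa * k == kappa + 2 * q)%N then a k else 0 in
  let B := if (kappa * l.-1 == q)%N then b l else 0 in
  [/\ rN < 0, c * y0 = kappa%:R * rN,
      A + B * y0 = (kappa + q)%:R * y0 * rN & rN * q.+1%:R <= B].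
Proof.
have sum_nat (m n p : nat) : (m + n = p)%N -> m%:R + n%:R = p%:R :> R.
  by move=> <-; rewrite natrD.
case: cs => /= k2 l2 c0.
- case=> kl _ ak0.
  have -> : (2 * k == 2 + 2 * k.-1)%N by move: k2; clear; lia.
  have -> : (2 * l.-1 == k.-1)%N = false by move: l2 kl; clear; lia.
  rewrite mul0r addr0 /R_N /Ky (_ : 2 + k.-1 = k.+1)%N; last by move: k2; clear; lia.
  have k0 : (0 : R) < k.+1%:R by rewrite ltr0n.
  set z := 2 * a k / (c * k.+1%:R).
  have z0 : 0 < z by rewrite divr_gt0 ?mulr_gt0.
  have s0 : 0 < Num.sqrt z by rewrite sqrtr_gt0.
  have sz : Num.sqrt z ^+ 2 = z by rewrite sqr_sqrtr // ltW.
  have cs0 : 0 < c * Num.sqrt z by rewrite mulr_gt0.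
  have r0 : c / 2 * - Num.sqrt z < 0 by lra.
  split => //.
  + by field.
  + have -> : k.+1%:R * - Num.sqrt z * (c / 2 * - Num.sqrt z) =
      k.+1%:R * c / 2 * Num.sqrt z ^+ 2 by field.
    by rewrite sz /z; field; rewrite !gt_eqF.
  + by rewrite nmulr_rle0.
- case=> kl _ bl0 [ak0 _].
  have -> : (1 * k == 1 + 2 * l.-1)%N by move: l2 kl; clear; lia.
  have -> : (1 * l.-1 == l.-1)%N by rewrite mul1n.
  rewrite /R_N /Ky (_ : 1 + l.-1 = l)%N; last by move: l2; clear; lia.
  rewrite prednK ?(ltnW l2) //.
  have l0 : (0 : R) < l%:R by rewrite ltr0n ltnW.
  set z := b l ^+ 2 + 4 * c * a k * l%:R.
  have z0 : b l ^+ 2 < z by rewrite /z ltrDl !mulr_gt0.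
  have s0 : 0 <= Num.sqrt z by rewrite sqrtr_ge0.
  have sz : Num.sqrt z ^+ 2 = z.
    by rewrite sqr_sqrtr // (le_trans _ (ltW z0)) // sqr_ge0.
  have : `|b l| < Num.sqrt z.
    by rewrite -ltr_sqr ?nnegrE // real_normK ?num_real // sz.
  rewrite ltr_norml => /andP[sb bs].
  have rE : c * ((b l - Num.sqrt z) / (2 * c * l%:R)) = (b l - Num.sqrt z) / (2 * l%:R).
    by field; rewrite !gt_eqF.
  split => //.
  + by rewrite rE pmulr_llt0 ?invr_gt0 ?mulr_gt0 // subr_lt0.
  + by rewrite mul1r.
  + rewrite rE; have -> : l%:R * ((b l - Num.sqrt z) / (2 * c * l%:R)) *
      ((b l - Num.sqrt z) / (2 * l%:R)) =
      (b l ^+ 2 - 2 * b l * Num.sqrt z + Num.sqrt z ^+ 2) / (4 * c * l%:R).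
      by field; rewrite !gt_eqF.
    by rewrite sz /z; field; rewrite !gt_eqF.
  + rewrite rE.
    have -> : (b l - Num.sqrt z) / (2 * l%:R) * l%:R = (b l - Num.sqrt z) / 2.
      by field; rewrite gt_eqF.
    lra.
- case=> kl _ bl0.
  have -> : (1 * k == 1 + 2 * l.-1)%N = false by move: l2 kl; clear; lia.
  have -> : (1 * l.-1 == l.-1)%N by rewrite mul1n.
  rewrite /R_N /Ky (_ : 1 + l.-1 = l)%N; last by move: l2; clear; lia.
  rewrite prednK ?(ltnW l2) // add0r.
  have l0 : (0 : R) < l%:R by rewrite ltr0n ltnW.
  have rE : c * (b l / (c * l%:R)) = b l / l%:R by field; rewrite !gt_eqF.
  split.
  + by rewrite rE pmulr_llt0 // invr_gt0.
  + by rewrite mul1r.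
  + by rewrite rE; field; rewrite !gt_eqF.
  + by rewrite rE divfK // gt_eqF.
Qed.

Lemma eqO_at_right0 (R : realType) (f : R -> R) (B rho : R) (p : nat) :
  0 < rho -> (forall t, 0 <= t -> t < rho -> `|f t| <= B * t ^+ p) ->
  f =O_ (0^'+) (fun t => t ^+ p).
Proof.
move=> rho0 H; apply/eqO_exP; exists (Num.max B 1).
  by rewrite lt_max ltr01 orbT.
near=> t; have t0 : 0 < t by near: t; exact: nbhs_right_gt.
have trho : t < rho by near: t; exact: nbhs_right_lt.
apply: (le_trans (H _ (ltW t0) trho)); rewrite ger0_norm ?exprn_ge0 ?(ltW t0) //.
by rewrite ler_wpM2r ?exprn_ge0 ?(ltW t0) // le_max lexx.
Unshelve. all: by end_near. Qed.

Theorem theorem2p1 (R : realType) (U : set (R * R)) (F : R * R -> R * R)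
    (c : R) (k l r : nat) (a b : nat -> R) (u : {poly {poly R}})
    (g : R * R -> R) (cs : reduced_case)
    (U_open : open U) (U0 : U 0)
    (F_analytic : analytic_map_on U F)
    (F_reduced : reduced_form U F c k l r a b u g)
    (F_case : in_case cs k l a b)
    (F_sign : sign_condition cs k l a b) :
  exists (rho : R) (K : R -> R * R) (rN r2N1 : R),
    let N := case_N cs k l in
    let P : {poly R} := 'X + rN *: 'X^N + r2N1 *: 'X^(2 * N - 1) in
    [/\ 0 < rho,
        C1_curve rho K /\ analytic_curve rho K,
        K_asymptotics cs c k l a b K,
        rN = R_N cs c k l a b
      & forall t : R, t \in `[0, rho[ ->
          [/\ U (K t), P.[t] \in `[0, rho[ & F (K t) = K P.[t]]].
Proof.
have [c0 [kr lr] [v uE] FE [fT _ _ _]] := F_reduced.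
have [C [e [e0 C_sum f_sum]] [C0 Ck C1 Cl]] := reduced_form_coefs kr lr uE fT.
have [S C_bounded] := square_sum_bounded e0 C_sum.
have k2 : (2 <= k)%N by case/andP: kr.
have l2 : (2 <= l)%N by case/andP: lr.
have [q0 kappa0 wk wl yE] := case_exponents k2 l2 F_case.
have [rN0 cy0 bal slope] := case_balance k2 l2 c0 F_case F_sign.
set kappa := xexp cs in kappa0 wk wl yE cy0 bal slope.
set q := (case_N cs k l).-1 in q0 wk wl yE cy0 bal slope.
have qN : q.+1 = case_N cs k l.
  by move: q0; rewrite /q; case: (case_N cs k l).
have [delta delta0 deltaU] : exists2 delta : R, 0 < delta &
    forall z : R * R, `|z| < delta -> U z.
  have /nbhs_ballP[delta /= d0 dU] : nbhs (0 : R * R) U by exact: open_nbhs_nbhs.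
  exists delta => // z zd; apply: dU.
  by rewrite -ball_normE /ball_ /= sub0r normrN.
have C_weight := reduced_weight wk wl C0 C1.
(* Every truncation of order at least [m1] contains both candidate leading monomials. *)
pose m1 := (k + l).+1.
have lead E m : (m1 <= m)%N -> _ := fun m1m =>
  @lead_sumE R kappa q k l C kappa0 wk wl C0 C1 E m
    (leq_ltn_trans (leq_addr l k) m1m) (leq_ltn_trans (leq_addl k l) m1m)
    (leq_ltn_trans (leq_trans (ltnW k2) (leq_addr l k)) m1m).
set y0 := Ky cs c k l a b in cy0 bal.
set rN := R_N cs c k l a b in rN0 cy0 bal slope.
have lead_balance m : (m1 <= m)%N ->
    lead_sum kappa q C m (fun i j => y0 ^+ j) = (kappa + q)%:R * y0 * rN.
  move=> /lead ->; rewrite -bal Ck Cl expr0 expr1 mulr1; congr (_ + _).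
  by case: ifP; rewrite ?mul0r.
have lead_slope m : (m1 <= m)%N ->
    rN * q.+1%:R <= lead_sum kappa q C m (fun i j => j%:R * y0 ^+ j.-1).
  by move=> /lead ->; rewrite Cl mulr0n mul0r mulr0 if_same add0r !mulr1.
have f_sum0 (h : R * R) : `|h| < e ->
    (fun n => \sum_(i < n) \sum_(j < n) C i j * h.1 ^+ i * h.2 ^+ j) @ \oo
      --> ((F h).2 - h.2).
  by move=> he; have := f_sum h he; rewrite add0r.
have [rho [d [B [K [/andP[rho0 rho1] KC1 Kan Kas Kinv]]]]] :=
  @invariant_curve R kappa q m1 c rN y0 e S delta C (fun z => (F z).2 - z.2)
    q0 kappa0 C_weight e0 delta0 rN0 c0 C_bounded cy0 lead_balance lead_slope f_sum0.
exists rho, K, rN, d => /=.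
have -> : 'X + rN *: 'X^(case_N cs k l) + d *: 'X^(2 * case_N cs k l - 1) =
    inner_map q rN d.
  have -> : (2 * case_N cs k l - 1 = (2 * q).+1)%N.
    by rewrite -qN; clear; lia.
  by rewrite -qN /inner_map /inner_factor -!mul_polyC !exprS; ring.
split => //.
- rewrite /K_asymptotics -yE -/kappa; split.
    by apply: (@eqO_at_right0 _ _ B _ _ rho0) => t t0 trho; have [] := Kas t t0 trho.
  by apply: (@eqO_at_right0 _ _ B _ _ rho0) => t t0 trho; have [] := Kas t t0 trho.
move=> t; rewrite in_itv /= => /andP[t0 trho].
have [Kd Frho KX KY] := Kinv t t0 trho.
have UK := deltaU _ Kd.
split => //.
rewrite [RHS]surjective_pairing KX KY [(K t).2 + _]addrC subrK.
rewrite {1}[F (K t)]surjective_pairing; congr (_, _).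
by have := FE (K t).1 (K t).2; rewrite -surjective_pairing => ->.
Qed.
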